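(* Consider $n$ nodes with states $x_i(t)\in\mathbb{R}^m$ and inputs $u_i(t)\in\mathbb{R}^m$ ($i\in\mathcal V=\{1,\dots,n\}$), interacting over an undirected graph $\mathcal G=(\mathcal V,\mathcal E)$, with dynamics $$\dot x_i(t)=f_i(x_i(t))+g_i(x_i(t))\,u_i(t-d),\qquad i=1,\dots,n,$$ where $d>0$ is a constant input delay and $f_i:\mathbb{R}^m\to\mathbb{R}^m$, $g_i:\mathbb{R}^m\to\mathbb{R}$ are smooth with $f_i(0)=0$. Consider the problem $$\min_{x\in\mathbb{R}^{nm}}\Phi(x)=\sum_{i=1}^n\phi_i(x_i)\quad\text{subject to } x_i=x_j\ \ \forall i,j\in\mathcal V ,$$ whose set of optimal solutions is nonempty with finite optimal value. Assume: (A1) for each $i$, $g_i$ is $C^1$ and there exist constants $0<\underline g_i\le\overline g_i<\infty$ with $\underline g_i\le|g_i(x)|\le\overline g_i$ for all $x\in\mathbb{R}^m$; (A2) each $\phi_i:\mathbb{R}^m\to\mathbb{R}$ is twice continuously differentiable and there is a constant $L_{\phi_i}$ with $\|\nabla\phi_i(y)-\nabla\phi_i(z)\|\le L_{\phi_i}\|y-z\|$ for all $y,z\in\mathbb{R}^m$; (A3) each $\phi_i$ is strongly convex with a parameter $m_{\phi_i}>0$, i.e. $\phi_i(\theta y+(1-\theta)z)\le\theta\phi_i(y)+(1-\theta)\phi_i(z)-\frac{m_{\phi_i}}{2}\theta(1-\theta)\|y-z\|^2$ for all $y,z\in\mathbb{R}^m$, $\theta\in[0,1]$. Let the inputs be given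 by the SIDT algorithm (defined in the context) with gains $\vartheta>0$, $k_0>0$ and $\varepsilon$. If $\varepsilon\ge 2n$, then the closed-loop system exhibits practical input-delay tolerant semiglobal convergence (practical IDTSC, defined in the context) for this optimization problem.
   Context: Graph: $\mathcal N_i=\{j\in\mathcal V:(i,j)\in\mathcal E\}$ is the neighborhood of node $i$; the adjacency weights satisfy $a_{ij}=a_{ji}>0$ if $(i,j)\in\mathcal E$ and $a_{ij}=0$ otherwise. SIDT algorithm: with constants $\vartheta>0$, $k_0>0$, $\varepsilon$, set $$u_i(t-d)=g_i(x_i(t-d))^{-1}\big(\bar u_i(t-d)-f_i(x_i(t-d))\big),$$ $$\bar u_i(t-d)=\vartheta\sum_{j=1}^n a_{ij}\big(x_j(t-d)-x_i(t-d)\big)+\varepsilon\sum_{j\in\mathcal N_i}\wp_{ij}(t-d)\,\mathrm{sign}\big(x_j(t-d)-x_i(t-d)\big)+\bar u_{\eta,i}(t-d),$$ $$\bar u_{\eta,i}(t-d)=-k_0\nabla\phi_i(x_i(t-d)),\qquad \wp_{ij}(t-d)=\|\bar u_{\eta,i}(t-d)\|+\|\bar u_{\eta,j}(t-d)\|.$$ Here $\mathrm{sign}$ acts componentwise on vectors, with $\mathrm{sign}(0)=0$. The right-hand side is discontinuous; solutions of the closed loop are absolutely continuous on $[0,\infty)$, extend the initial history, and satisfy the equation for almost every $t\ge 0$. Optimal solution: $x^*=(x_1^*,\dots,x_n^* )\in\mathbb{R}^{nm}$, with $x_i^*=x_j^*$ for all $i,j$, denotes the optimal solution of the constrained problem.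 Initial histories: for $r>0$, $\mathcal B_r(x_i^* )=\{\varphi\in C([-d,0],\mathbb{R}^m):\sup_{s\in[-d,0]}\|\varphi(s)-x_i^*\|\le r\}$. Practical IDTSC: for every $r>0$ there exists a maximal allowable delay $\bar d=\bar d(r)>0$ such that for every $d\in(0,\bar d]$ there is a finite constant $\rho=\rho(r,d)\ge 0$ (independent of the particular initial history) such that, for all initial histories with $x_i|_{[-d,0]}\in\mathcal B_r(x_i^* )$ for every $i\in\mathcal V$, the closed-loop trajectory $x(t)=(x_1(t),\dots,x_n(t))$ is well defined for all $t\ge 0$, is bounded, and satisfies $\limsup_{t\to\infty}\|x(t)-x^*\|\le\rho$, i.e. it converges to a neighborhood of $x^*$ and is uniformly ultimately bounded with respect to $x^*$. The bounds $\bar d$ and $\rho$ may depend on the problem data and gains. *)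

(* Defs.v *)
From HB Require Import structures.
From mathcomp Require Import all_boot all_order all_algebra.
From mathcomp Require Import all_classical all_reals all_analysis.

Set Implicit Arguments.
Unset Strict Implicit.
Unset Printing Implicit Defensive.

Import Order.TTheory GRing.Theory Num.Theory.
Import numFieldNormedType.Exports.

Local Open Scope classical_set_scope.
Local Open Scope ring_scope.

(* A stacked vector [x = (x_1, ..., x_n)] of R^(nm) is a matrix ['M[R]_(n, m)]
   whose [i]-th row is the node state [x_i]. *)

(* The library norm on matrices is the sup norm; this is the Euclidean one,
   both on ['rV[R]_m] and on stacked vectors. *)
Definition enorm (R : realType) (p q : nat) (A : 'M[R]_(p, q)) : R :=
  Num.sqrt (\sum_i \sum_j A i j ^+ 2).

Definition partial (R : realType) (m : nat) (V : normedModType R)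
    (j : 'I_m) (f : 'rV[R]_m -> V) : 'rV[R]_m -> V :=
  fun x => 'D_(delta_mx 0 j) f x.

Fixpoint Ck (R : realType) (m : nat) (V : normedModType R) (k : nat)
    (f : 'rV[R]_m -> V) : Prop :=
  match k with
  | 0%N => continuous f
  | k'.+1 => continuous f /\
      forall j : 'I_m, (forall x, derivable f x (delta_mx 0 j)) /\
                       Ck k' (partial j f)
  end.

Definition smooth (R : realType) (m : nat) (V : normedModType R)
    (f : 'rV[R]_m -> V) : Prop := forall k : nat, Ck k f.

Definition grad (R : realType) (m : nat) (phi : 'rV[R]_m -> R)
    (x : 'rV[R]_m) : 'rV[R]_m := \row_j partial j phi x.

Definition strongly_convex (R : realType) (m : nat) (mu : R)
    (phi : 'rV[R]_m -> R) : Prop :=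
  forall (y z : 'rV[R]_m) (theta : R), 0 <= theta <= 1 ->
    phi (theta *: y + (1 - theta) *: z) <=
      theta * phi y + (1 - theta) * phi z
      - mu / 2 * theta * (1 - theta) * enorm (y - z) ^+ 2.

Definition abs_continuous (R : realType) (p q : nat) (a b : R)
    (x : R -> 'M[R]_(p, q)) : Prop :=
  forall e : R, 0 < e -> exists2 delta : R, 0 < delta &
    forall (N : nat) (u v : 'I_N -> R),
      (forall k, [/\ a <= u k, u k <= v k & v k <= b]) ->
      (forall k l, k != l -> v k <= u l \/ v l <= u k) ->
      \sum_k (v k - u k) < delta ->
      \sum_k enorm (x (v k) - x (u k)) < e.

Definition consensus (R : realType) (n m : nat) (X : 'M[R]_(n, m)) : Prop :=
  forall i j : 'I_n, row i X = row j X.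

Definition objective (R : realType) (n m : nat) (phi : 'I_n -> 'rV[R]_m -> R)
    (X : 'M[R]_(n, m)) : R := \sum_i phi i (row i X).

Definition optimal_solution (R : realType) (n m : nat)
    (phi : 'I_n -> 'rV[R]_m -> R) (X : 'M[R]_(n, m)) : Prop :=
  consensus X /\
  forall Y : 'M[R]_(n, m), consensus Y -> objective phi X <= objective phi Y.

Definition sign_vec (R : realType) (m : nat) (v : 'rV[R]_m) : 'rV[R]_m :=
  map_mx Num.sg v.

Definition ubar_eta (R : realType) (n m : nat) (phi : 'I_n -> 'rV[R]_m -> R)
    (k0 : R) (i : 'I_n) (X : 'M[R]_(n, m)) : 'rV[R]_m :=
  - (k0 *: grad (phi i) (row i X)).

Definition wp (R : realType) (n m : nat) (phi : 'I_n -> 'rV[R]_m -> R)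
    (k0 : R) (i j : 'I_n) (X : 'M[R]_(n, m)) : R :=
  enorm (ubar_eta phi k0 i X) + enorm (ubar_eta phi k0 j X).

Definition ubar (R : realType) (n m : nat) (E : rel 'I_n) (a : 'I_n -> 'I_n -> R)
    (phi : 'I_n -> 'rV[R]_m -> R) (vartheta k0 eps : R)
    (i : 'I_n) (X : 'M[R]_(n, m)) : 'rV[R]_m :=
  vartheta *: (\sum_j a i j *: (row j X - row i X))
  + eps *: (\sum_(j | E i j) wp phi k0 i j X *: sign_vec (row j X - row i X))
  + ubar_eta phi k0 i X.

(* The SIDT input as a static feedback: [u_i(t - d) = sidt_input ... i (x(t - d))]. *)
Definition sidt_input (R : realType) (n m : nat) (E : rel 'I_n)
    (a : 'I_n -> 'I_n -> R) (f : 'I_n -> 'rV[R]_m -> 'rV[R]_m)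
    (g : 'I_n -> 'rV[R]_m -> R) (phi : 'I_n -> 'rV[R]_m -> R)
    (vartheta k0 eps : R) (i : 'I_n) (X : 'M[R]_(n, m)) : 'rV[R]_m :=
  (g i (row i X))^-1 *: (ubar E a phi vartheta k0 eps i X - f i (row i X)).

Definition history_ball (R : realType) (m : nat) (d r : R) (c : 'rV[R]_m)
    : set (R -> 'rV[R]_m) :=
  [set h : R -> 'rV[R]_m | {within `[- d, 0], continuous h} /\
     (ereal_sup [set (enorm (h s - c)%R)%:E | s in `[(- d)%R, 0%R]] <= r%:E)%E].

(* Trajectories are total functions of time; only their values on
   [[- d, +oo[] are meaningful. *)
Definition closed_loop_solution (R : realType) (n m : nat)
    (f : 'I_n -> 'rV[R]_m -> 'rV[R]_m) (g : 'I_n -> 'rV[R]_m -> R)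
    (u : 'I_n -> 'M[R]_(n, m) -> 'rV[R]_m) (d : R)
    (h : 'I_n -> R -> 'rV[R]_m) (x : R -> 'M[R]_(n, m)) : Prop :=
  [/\ forall (i : 'I_n) (s : R), - d <= s <= 0 -> row i (x s) = h i s,
      forall T : R, 0 <= T -> abs_continuous 0 T x &
      {ae @lebesgue_measure R, forall t : R, 0 <= t -> forall i : 'I_n,
        is_derive t 1 (fun s => row i (x s))
          (f i (row i (x t)) + g i (row i (x t)) *: u i (x (t - d)))}].

(* "Well defined" is existence and uniqueness on [[- d, +oo[].  The last clause
   is uniform ultimate boundedness: the time [T] after which the trajectories
   have entered a ball of radius larger than [rho] does not depend on the
   initial history. *)
Definition practical_IDTSC (R : realType) (n m : nat)
    (f : 'I_n -> 'rV[R]_m -> 'rV[R]_m) (g : 'I_n -> 'rV[R]_m -> R)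
    (u : 'I_n -> 'M[R]_(n, m) -> 'rV[R]_m) (xstar : 'M[R]_(n, m)) : Prop :=
  forall r : R, 0 < r -> exists2 dbar : R, 0 < dbar &
  forall d : R, 0 < d <= dbar -> exists2 rho : R, 0 <= rho &
    (forall h : 'I_n -> R -> 'rV[R]_m,
       (forall i, history_ball d r (row i xstar) (h i)) ->
       exists x : R -> 'M[R]_(n, m),
         [/\ closed_loop_solution f g u d h x,
             forall y, closed_loop_solution f g u d h y ->
               forall t, - d <= t -> y t = x t,
             exists M : R, forall t, - d <= t -> enorm (x t) <= M &
             (limf_esup (fun t => (enorm (x t - xstar)%R)%:E) (pinfty_nbhs R)
                <= rho%:E)%E]) /\
    (forall b : R, rho < b -> exists2 T : R, 0 <= T &
       forall (h : 'I_n -> R -> 'rV[R]_m) (x : R -> 'M[R]_(n, m)),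
         (forall i, history_ball d r (row i xstar) (h i)) ->
         closed_loop_solution f g u d h x ->
         forall t, T <= t -> enorm (x t - xstar) <= b).

(* Main.v *)
Require Import Defs.
From HB Require Import structures.
From mathcomp Require Import all_boot all_order all_algebra.
From mathcomp Require Import all_classical all_reals all_analysis.
From mathcomp Require Import measurable_realfun ring lra.

Set Implicit Arguments.
Unset Strict Implicit.
Unset Printing Implicit Defensive.

Import Order.TTheory GRing.Theory Num.Theory.
Import numFieldNormedType.Exports.

Local Open Scope classical_set_scope.
Local Open Scope ring_scope.

(** The conclusion asks for well-posedness and for a bound that is uniform over
    the initial histories in a ball.  Both follow from a Lyapunov argument for
    the function [|X - x*|^2], treating the delay as a small perturbation.

    Write the closed loop as [x'(t) = F (x t) (x (t - d))], where [F X Y]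
    evaluates [f] and [g] at the current state [X] and the input at the delayed
    state [Y].  On the diagonal the feedback linearization is exact: [F Y Y] is
    the consensus-plus-gradient field.  Its diffusive and sign couplings are
    symmetric and built from odd functions of the differences of the states, so
    they are dissipative with respect to any consensus point
    ([coupling_dissipative]), while strong convexity makes the gradient term
    coercive ([strongly_convex_coercive]).  Hence [<Y - x*, F Y Y> <= - k0] off
    some ball ([closed_loop_field_coercive]).

    On a fixed box around [x*] the field [F] is bounded by some [K] and is
    [L]-Lipschitz in [X], although it is discontinuous in [Y].  A trajectory in
    the box is [K]-Lipschitz, so [|x t - x (t - d)| <= K d] and the delay adds
    only a term of order [d] to the derivative of [|x - x*|^2]
    ([delayed_dissipation]).  For small [d] the trajectory therefore cannot
    leave a ball that contains the histories in its interior
    ([a_priori_bound]).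

    Existence and uniqueness use the method of steps: on each interval of length
    [d] the delayed argument is known, and the equation is a Caratheodory
    equation with a Lipschitz right-hand side, for which Picard iteration
    contracts as soon as [L d <= 1/2] ([picard_step], [delay_solution_unique]).
    The iteration is run for the field clipped to the box, and the a priori
    bound shows that clipping has no effect.

    The bridge between almost-everywhere derivatives and increments is
    [ae_derive_le]: an absolutely continuous function whose derivative is at
    most [K >= 0] almost everywhere grows at rate at most [K]. *)

(** * Euclidean inner product and norms on matrices *)

(** The Frobenius inner product, whose associated norm is [enorm]. *)
Definition mdot (R : realType) (p q : nat) (A B : 'M[R]_(p, q)) : R :=
  \sum_i \sum_j A i j * B i j.

Section Norms.
Context {R : realType} {p q : nat}.
Implicit Types A B C : 'M[R]_(p, q).

Lemma mx_norm_leP A (M : R) : 0 <= M ->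
  (forall i j, `|A i j| <= M) -> `|A| <= M.
Proof.
move=> M0 AM; rewrite [leLHS]/Num.Def.normr/= mx_normrE.
by apply: bigmax_le => // -[i j] _ /=.
Qed.

Lemma le_coord_mx_norm A i j : `|A i j| <= `|A|.
Proof.
by rewrite [leRHS]/Num.Def.normr/= mx_normrE; exact: (le_bigmax _ _ (i, j)).
Qed.

Lemma mdotC A B : mdot A B = mdot B A.
Proof. by apply: eq_bigr => i _; apply: eq_bigr => j _; rewrite mulrC. Qed.

Lemma mdotDr A B C : mdot A (B + C) = mdot A B + mdot A C.
Proof.
rewrite /mdot -big_split; apply: eq_bigr => i _.
by rewrite -big_split; apply: eq_bigr => j _; rewrite mxE mulrDr.
Qed.

Lemma mdotZr A B (t : R) : mdot A (t *: B) = t * mdot A B.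
Proof.
rewrite /mdot mulr_sumr; apply: eq_bigr => i _.
by rewrite mulr_sumr; apply: eq_bigr => j _; rewrite mxE mulrCA.
Qed.

Lemma mdotNr A B : mdot A (- B) = - mdot A B.
Proof. by rewrite -scaleN1r mdotZr mulN1r. Qed.

Lemma mdotDl A B C : mdot (A + B) C = mdot A C + mdot B C.
Proof. by rewrite mdotC mdotDr !(mdotC C). Qed.

Lemma mdotNl A B : mdot (- A) B = - mdot A B.
Proof. by rewrite mdotC mdotNr mdotC. Qed.

Lemma mdot_ge0 A : 0 <= mdot A A.
Proof. by apply: sumr_ge0 => i _; apply: sumr_ge0 => j _; rewrite -expr2 sqr_ge0. Qed.

Lemma enorm_ge0 A : 0 <= enorm A.
Proof. exact: sqrtr_ge0. Qed.

Lemma sqr_enorm A : enorm A ^+ 2 = mdot A A.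
Proof.
rewrite sqr_sqrtr; last by apply: sumr_ge0 => i _; apply: sumr_ge0 => j _; exact: sqr_ge0.
by apply: eq_bigr => i _; apply: eq_bigr => j _; rewrite expr2.
Qed.

Lemma enormN A : enorm (- A) = enorm A.
Proof.
by congr Num.sqrt; apply: eq_bigr => i _; apply: eq_bigr => j _; rewrite mxE sqrrN.
Qed.

Lemma coord_le_enorm A i j : `|A i j| <= enorm A.
Proof.
rewrite -sqrtr_sqr; apply: ler_wsqrtr.
rewrite (bigD1 i)//= (bigD1 j)//= -addrA lerDl.
apply: addr_ge0; first by apply: sumr_ge0 => k _; exact: sqr_ge0.
by apply: sumr_ge0 => k _; apply: sumr_ge0 => l _; exact: sqr_ge0.
Qed.

Lemma mx_norm_le_enorm A : `|A| <= enorm A.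
Proof. by apply: mx_norm_leP (enorm_ge0 A) _ => i j; exact: coord_le_enorm. Qed.

Lemma enorm0_eq0 A : enorm A = 0 -> A = 0.
Proof.
move=> A0; apply/matrixP => i j; rewrite mxE; apply/eqP; rewrite -normr_le0.
by rewrite -A0 coord_le_enorm.
Qed.

Lemma mdot0r A : mdot A 0 = 0.
Proof. by rewrite -(scale0r 0) mdotZr mul0r. Qed.

(** The Cauchy-Schwarz inequality. *)
Lemma mdot_le_enorm A B : mdot A B <= enorm A * enorm B.
Proof.
have [/enorm0_eq0->|A0] := eqVneq (enorm A) 0.
  by rewrite mdotC mdot0r mulr_ge0 ?enorm_ge0.
have [/enorm0_eq0->|B0] := eqVneq (enorm B) 0.
  by rewrite mdot0r mulr_ge0 ?enorm_ge0.
have Agt0 : 0 < enorm A by rewrite lt_def A0 enorm_ge0.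
have Bgt0 : 0 < enorm B by rewrite lt_def B0 enorm_ge0.
have := mdot_ge0 (enorm B *: A - enorm A *: B).
have -> : mdot (enorm B *: A - enorm A *: B) (enorm B *: A - enorm A *: B) =
  2 * (enorm A * enorm B) * (enorm A * enorm B - mdot A B).
  rewrite mdotDr !mdotDl !mdotNr !mdotNl !mdotZr !(mdotC (_ *: _)) !mdotZr.
  by rewrite -!sqr_enorm (mdotC B A); ring.
by rewrite pmulr_rge0 ?mulr_gt0// subr_ge0.
Qed.

Lemma enormD A B : enorm (A + B) <= enorm A + enorm B.
Proof.
rewrite -(@ler_pXn2r _ 2)// ?nnegrE ?addr_ge0 ?enorm_ge0//.
rewrite sqr_enorm mdotDr !mdotDl -!sqr_enorm (mdotC B A).
have := mdot_le_enorm A B; lra.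
Qed.

Lemma normr_mdot_le A B : `|mdot A B| <= (p * q)%:R * (`|A| * `|B|).
Proof.
have -> : (p * q)%:R * (`|A| * `|B|) = \sum_(i < p) \sum_(j < q) (`|A| * `|B|).
  by rewrite !sumr_const !card_ord -mulrnA mulnC mulr_natl.
apply: le_trans (ler_norm_sum _ _ _) _; apply: ler_sum => i _.
apply: le_trans (ler_norm_sum _ _ _) _; apply: ler_sum => j _.
by rewrite normrM; apply: ler_pM => //; exact: le_coord_mx_norm.
Qed.

Lemma enorm_le_mx_norm A : enorm A <= (p * q)%:R * `|A|.
Proof.
rewrite -(@ler_pXn2r _ 2)// ?nnegrE ?mulr_ge0 ?enorm_ge0//.
rewrite sqr_enorm; apply: le_trans (ler_norm _) _.
apply: le_trans (normr_mdot_le _ _) _.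
rewrite exprMn -expr2; apply: ler_wpM2r; first exact: sqr_ge0.
by rewrite -natrX ler_nat; case: (p * q)%N => // k; rewrite expnS expn1 leq_pmull.
Qed.

End Norms.

(** * Absolutely continuous functions with a bounded derivative *)

Section AbsoluteContinuity.
Context {R : realType}.
Implicit Types (h : R -> R) (a b s t : R).
Local Notation mu := (@lebesgue_measure R).

(** Cousin's lemma: an interval predicate that is stable under concatenation
    and holds for all small intervals around each point holds globally. *)
Lemma cousin (P : R -> R -> Prop) a b : a <= b ->
  (forall s t u, a <= s -> s <= t -> t <= u -> u <= b ->
    P s t -> P t u -> P s u) ->
  (forall c, a <= c <= b -> exists2 d, 0 < d & forall s t,
    a <= s -> s <= c -> c <= t -> t <= b -> c - d < s -> t < c + d -> P s t) ->
  P a b.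
Proof.
move=> ab Ptrans Ploc.
pose S := [set t | a <= t <= b /\ P a t].
have Sa : S a.
  split; first by rewrite lexx.
  have [|d d0 H] := Ploc a; first by rewrite lexx.
  by apply: H; rewrite ?lexx// ?ltrBlDr ltrDl.
have hS : has_sup S.
  by split; [exists a|exists b => x [/andP[]]].
pose c := sup S.
have ac : a <= c by exact: ub_le_sup hS.2 _ Sa.
have cb : c <= b by apply: ge_sup; [exists a|move=> x [/andP[]]].
have [|d d0 H] := Ploc c; first by rewrite ac.
have [s [/andP[as_ sb] Ps] cs] := sup_adherent d0 hS.
have sc : s <= c by apply: ub_le_sup hS.2 _ _; split => //; rewrite as_.
pose c' := Num.min b (c + d / 2).
have cc' : c <= c' by rewrite le_min cb lerDl divr_ge0// ltW.
have c'b : c' <= b by rewrite ge_min lexx.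
have Pac' : P a c'.
  apply: (Ptrans a s c') => //; first exact: le_trans cc'.
  apply: H => //.
  by rewrite gt_min ltrD2l ltr_pdivrMr// ltr_pMr// ltr1n orbT.
have : c' <= c.
  by apply: ub_le_sup hS.2 _ _; split => //; rewrite c'b (le_trans ac).
rewrite ge_min => /orP[bc|]; last by rewrite gerDl leNgt divr_gt0.
have -> : b = c' by apply/eqP; rewrite eq_le c'b andbT (le_trans bc).
exact: Pac'.
Qed.

(** Absolute continuity on [[a, b]] of a real-valued function; for matrix
    paths this is [abs_continuous]. *)
Definition real_abs_continuous a b h : Prop :=
  forall e : R, 0 < e -> exists2 delta : R, 0 < delta &
    forall (N : nat) (u v : 'I_N -> R),
      (forall k, [/\ a <= u k, u k <= v k & v k <= b]) ->
      (forall k l, k != l -> v k <= u l \/ v l <= u k) ->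
      \sum_k (v k - u k) < delta -> \sum_k `|h (v k) - h (u k)| < e.

(** Absolute continuity tested on ordered lists of intervals. *)
Lemma real_abs_continuous_seq a b h : real_abs_continuous a b h ->
  forall e : R, 0 < e -> exists2 delta : R, 0 < delta &
    forall l : seq (R * R),
      all (fun p => (a <= p.1) && (p.1 <= p.2) && (p.2 <= b)) l ->
      pairwise (fun p q => p.2 <= q.1) l ->
      \sum_(p <- l) (p.2 - p.1) < delta ->
      \sum_(p <- l) `|h p.2 - h p.1| < e.
Proof.
move=> ach e e0; have [d d0 H] := ach e e0; exists d => // l lab ldisj.
rewrite (big_tnth _ _ l) => suml; rewrite (big_tnth _ _ l).
apply: (H (size l) (fun k => (tnth (in_tuple l) k).1)
                   (fun k => (tnth (in_tuple l) k).2)) => //.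
- move=> k; have := allP lab _ (mem_tnth k (in_tuple l)).
  by move=> /andP[/andP[]].
- move=> k k' kk'.
  have key (i j : 'I_(size l)) : (i < j)%N ->
      (tnth (in_tuple l) i).2 <= (tnth (in_tuple l) j).1.
    move=> ij; rewrite !(tnth_nth (0, 0)).
    by move/(pairwiseP (0, 0)) : ldisj => /(_ i j); apply; rewrite ?inE ?ltn_ord.
  by case: (ltngtP k k') => [/key|/key|/ord_inj/eqP]; [left|right|rewrite (negbTE kk')].
Qed.

Lemma is_derive_dist h (c l e : R) : is_derive c 1 h l -> 0 < e ->
  exists2 d, 0 < d & forall t, `|t - c| < d ->
    `|h t - h c - l * (t - c)| <= e * `|t - c|.
Proof.
move=> hcl e0.
have : (fun y => y^-1 *: (h (y *: 1 + c) - h c)) @ 0^' --> l.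
  have := @derive_val _ _ _ _ _ _ _ hcl; rewrite /derive => <-.
  exact: (@ex_derive _ _ _ _ _ _ _ hcl).
move=> /cvgrPdist_le /(_ _ e0) [/= d d0 dP]; exists d => // t tcd.
have [->|tc] := eqVneq t c; first by rewrite !subrr mulr0 subr0 normr0 mulr0.
have tc0 : t - c != 0 by rewrite subr_eq0.
have := dP (t - c); rewrite /ball_/= sub0r normrN => /(_ tcd tc0).
rewrite /GRing.scale/= mulr1 subrK distrC => H.
rewrite -ler_pdivrMr ?normr_gt0// -normfV -normrM.
by rewrite mulrBl mulfK// mulrC.
Qed.

(** The straddle lemma for the upper bound [K] on the derivative. *)
Lemma is_derive_straddle_le h (c l K e : R) : is_derive c 1 h l -> l <= K -> 0 < e ->
  exists2 d, 0 < d & forall s t, s <= c -> c <= t -> c - d < s -> t < c + d ->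
    h t - h s <= (K + e) * (t - s).
Proof.
move=> hcl lK e0; have [d d0 dP] := is_derive_dist hcl e0; exists d => //.
move=> s t sc ct cds tcd.
have /ler_normlP[_ ht] : `|h t - h c - l * (t - c)| <= e * (t - c).
  rewrite -[t - c in leRHS]ger0_norm ?subr_ge0//; apply: dP.
  by rewrite ger0_norm ?subr_ge0// ltrBlDl.
have /ler_normlP[hs _] : `|h s - h c - l * (s - c)| <= e * (c - s).
  rewrite -[c - s in leRHS]ger0_norm ?subr_ge0// (distrC c); apply: dP.
  by rewrite distrC ger0_norm ?subr_ge0// ltrBlDr -ltrBlDl.
have : l * (t - s) <= K * (t - s).
  by apply: ler_wpM2r => //; rewrite subr_ge0 (le_trans sc).
lra.
Qed.

Lemma lebesgue_measure_oc s t : s <= t -> mu `]s, t]%classic = (t - s)%:E.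
Proof.
move=> st; rewrite lebesgue_measure_itv/= lte_fin.
by move: st; rewrite le_eqVlt => /predU1P[->|->//]; rewrite ltxx subrr.
Qed.

(** An absolutely continuous function whose derivative is at most [K >= 0] almost
    everywhere grows at rate at most [K].  The exceptional null set is covered
    by an open set [U] of small measure; Cousin's lemma cuts [[a, b]] into
    intervals on which either the straddle estimate holds or which lie in [U],
    and absolute continuity controls the total increment over the latter. *)
Theorem ae_derive_le h a b (K : R) : 0 <= K -> a <= b -> real_abs_continuous a b h ->
  {ae mu, forall t, a <= t <= b -> exists2 l, l <= K & is_derive t 1 h l} ->
  h b - h a <= K * (b - a).
Proof.
move=> K0 ab ach aeh.
suff key eta : 0 < eta -> h b - h a <= (K + eta) * (b - a) + eta.
  apply/ler_addgt0Pr => e e0.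
  have c0 : 0 < e / (b - a + 1) by rewrite divr_gt0// ltr_wpDl// subr_ge0.
  have := key _ c0; rewrite mulrDl -addrA -[X in _ <= _ + (_ + X)]mulr1.
  by rewrite -mulrDr divfK// lt0r_neq0// ltr_wpDl// subr_ge0.
move=> eta0.
have [delta delta0 acP] := real_abs_continuous_seq ach eta0.
set N := ~` [set t | a <= t <= b -> exists2 l, l <= K & is_derive t 1 h l].
have N0 : mu.-negligible N by exact: aeh.
move/negligible_outer_measure : N0 => N0.
have d20 : 0 < delta / 2 by rewrite divr_gt0.
have [U [oU NU]] := outer_measure_open_le N d20.
rewrite [X in (_ <= X + _)%E](_ : _ = 0%E); last exact: N0.
rewrite add0e => muU.
have mU : measurable U by exact: open_measurable.
have mUoc s t : measurable (U `&` `]s, t]) by exact: measurableI.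
(* The intervals in [l] are the pieces of [[s, t]] that are charged to [U]. *)
pose P s t := exists l : seq (R * R),
  [/\ all (fun p => (s <= p.1) && (p.1 <= p.2) && (p.2 <= t)) l,
      pairwise (fun p q => p.2 <= q.1) l,
      ((\sum_(p <- l) (p.2 - p.1))%:E <= mu (U `&` `]s, t]))%E &
      h t - h s <= (K + eta) * (t - s) + \sum_(p <- l) `|h p.2 - h p.1|].
have : P a b.
  apply: cousin => //.
  - move=> s t u as_ st tu ub [l1 [all1 pw1 m1 h1]] [l2 [all2 pw2 m2 h2]].
    exists (l1 ++ l2); split.
    + rewrite all_cat; apply/andP; split.
        apply: sub_all all1 => -[p q]/= /andP[-> qt].
        by rewrite (le_trans qt).
      apply: sub_all all2 => -[p q]/= /andP[/andP[tp ->] ->].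
      by rewrite (le_trans st).
    + rewrite pairwise_cat pw1 pw2 !andbT.
      apply/allrelP => -[p1 q1] [p2 q2] /(allP all1)/= /andP[_ q1t].
      by move=> /(allP all2)/= /andP[/andP[tp2 _] _]; exact: le_trans tp2.
    + have -> : U `&` `]s, u] = (U `&` `]s, t]) `|` (U `&` `]t, u]).
        by rewrite -setIUr -(@itv_bndbnd_setU _ _ (BRight s) (BRight t) (BRight u)).
      have disj : (U `&` `]s, t]) `&` (U `&` `]t, u]) = set0.
        rewrite -subset0 => x [[_ /=]]; rewrite in_itv/= => /andP[_ xt].
        by case=> _ /=; rewrite in_itv/= ltNge xt.
      rewrite measureU; [|exact: mUoc|exact: mUoc|exact: disj].
      by rewrite big_cat/= EFinD; exact: leeD.
    + rewrite big_cat/=; lra.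
  - move=> c acb; have [cN|/contrapT cN] := pselect (N c).
      (* Near an exceptional point the interval itself lies in [U]. *)
      have [e /= e0 eU] : nbhs c U by apply: open_nbhs_nbhs; split => //; exact: NU.
      exists e => // s t as_ sc ct tb cs tc; exists [:: (s, t)]; split => /=.
      + by rewrite !lexx (le_trans sc).
      + by [].
      + rewrite big_seq1/=.
        have -> : U `&` `]s, t] = `]s, t]%classic.
          apply/setIidr => x /=; rewrite in_itv/= => /andP[sx xt]; apply: eU.
          rewrite /ball_/= ltr_distlC; apply/andP; split; lra.
        by rewrite lebesgue_measure_oc// (le_trans sc).
      + rewrite big_seq1/= -[leLHS]add0r; apply: lerD; last exact: ler_norm.
        by rewrite mulr_ge0 ?subr_ge0 ?(le_trans sc)// addr_ge0// ltW.
    (* Near a point of differentiability no interval of [U] is needed. *)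
    have [//|l lK hl] := cN; have [d d0 dP] := is_derive_straddle_le hl lK eta0.
    exists d => // s t _ sc ct _ cs tc; exists [::]; split => //=.
      by rewrite big_nil measure_ge0.
    by rewrite big_nil addr0; exact: dP.
move=> [l [alll pwl suml hl]].
apply: le_trans hl _; rewrite lerD2l ltW// acP//.
rewrite -lte_fin; apply: le_lt_trans suml _.
have subU : (mu (U `&` `]a, b]) <= mu U)%E by
  apply: le_measure; [rewrite inE; exact: mUoc|rewrite inE; exact: mU|exact: subIsetl].
apply: le_lt_trans subU _; apply: le_lt_trans muU _.
by rewrite lte_fin ltr_pdivrMr// ltr_pMr// ltr1n.
Qed.

End AbsoluteContinuity.

#[local] Instance lebesgue_ae_filter (R : realType) :
  Filter (almost_everywhere (@lebesgue_measure R)) :=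
  ae_filter_ringOfSetsType (@lebesgue_measure R).

Section AbsoluteContinuityTheory.
Context {R : realType}.
Implicit Types (h : R -> R) (a b s t : R).
Local Notation mu := (@lebesgue_measure R).

Lemma real_abs_continuousW a b a' b' h : a <= a' -> b' <= b ->
  real_abs_continuous a b h -> real_abs_continuous a' b' h.
Proof.
move=> aa' b'b ach e e0; have [d d0 H] := ach e e0; exists d => // N u v uv.
by apply: H => k; have [? ? ?] := uv k; split=> //; [exact: le_trans aa' _|exact: le_trans b'b].
Qed.

(** Absolute continuity passes to any real function whose increments are
    controlled by those of an absolutely continuous path. *)
Lemma real_abs_continuous_dominated (p q : nat) a b (x : R -> 'M[R]_(p, q)) h (M : R) :
  0 <= M -> abs_continuous a b x ->
  (forall u v, a <= u -> u <= v -> v <= b -> `|h v - h u| <= M * enorm (x v - x u)) ->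
  real_abs_continuous a b h.
Proof.
move=> M0 acx hM e e0.
have M1 : 0 < M + 1 by rewrite ltr_wpDl.
have [d d0 H] := acx _ (divr_gt0 e0 M1); exists d => // N u v uv disj sumd.
have := H N u v uv disj sumd; rewrite ltr_pdivlMr//; apply: le_lt_trans.
rewrite mulr_suml; apply: ler_sum => k _; have [auk uvk vkb] := uv k.
apply: le_trans (hM _ _ auk uvk vkb) _.
by rewrite mulrC ler_wpM2l ?enorm_ge0// lerDl.
Qed.

Lemma real_abs_continuous_coord (p q : nat) a b (x : R -> 'M[R]_(p, q)) i j :
  abs_continuous a b x -> real_abs_continuous a b (fun t => x t i j).
Proof.
move=> acx; apply: real_abs_continuous_dominated ler01 acx _ => u v _ _ _.
by rewrite mul1r; have := coord_le_enorm (x v - x u) i j; rewrite !mxE.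
Qed.

Lemma real_abs_continuousN a b h :
  real_abs_continuous a b h -> real_abs_continuous a b (fun t => - h t).
Proof.
move=> ach e e0; have [d d0 H] := ach e e0; exists d => // N u v uv disj sumd.
rewrite (eq_bigr (fun k => `|h (v k) - h (u k)|)); first exact: H.
by move=> k _; rewrite opprK addrC distrC.
Qed.

Lemma real_abs_continuousB a b h k :
  real_abs_continuous a b h -> real_abs_continuous a b k ->
  real_abs_continuous a b (fun t => h t - k t).
Proof.
move=> ach ack e e0; have e20 : 0 < e / 2 by rewrite divr_gt0.
have [d d0 H] := ach _ e20; have [d' d'0 H'] := ack _ e20.
exists (Num.min d d'); first by rewrite lt_min d0.
move=> N u v uv disj; rewrite lt_min => /andP[sumd sumd'].
have := ltrD (H N u v uv disj sumd) (H' N u v uv disj sumd').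
rewrite -splitr; apply: le_lt_trans; rewrite -big_split/=; apply: ler_sum => i _.
apply: le_trans (ler_normB _ _); rewrite le_eqVlt; apply/orP; left; apply/eqP.
by congr `|_|; ring.
Qed.

(** Uniform continuity, from the case of a single interval. *)
Lemma real_abs_continuous_dist a b h e : real_abs_continuous a b h -> 0 < e ->
  exists2 d, 0 < d & forall s t, a <= s <= b -> a <= t <= b -> `|s - t| < d ->
    `|h s - h t| < e.
Proof.
move=> ach e0; have [d d0 H] := ach e e0; exists d => // s t.
wlog st : s t / s <= t.
  move=> W sab tab; have [st|/ltW ts] := leP s t; first exact: W.
  by rewrite distrC (distrC (h s)); exact: W.
move=> /andP[as_ sb] /andP[at_ tb] std.
have := H 1%N (fun=> s) (fun=> t) => /(_ _ _ _).
rewrite !big_ord1 (distrC (h s)); apply => //.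
- by move=> k l; rewrite !ord1.
- by move: std; rewrite distrC ger0_norm// subr_ge0.
Qed.

Lemma ae_derive_dist_le h a b (K : R) : 0 <= K -> real_abs_continuous a b h ->
  {ae mu, forall t, a <= t <= b -> exists2 l, `|l| <= K & is_derive t 1 h l} ->
  forall s t, a <= s -> s <= t -> t <= b -> `|h t - h s| <= K * (t - s).
Proof.
move=> K0 ach aeh s t as_ st tb.
have ach' : real_abs_continuous s t h by exact: real_abs_continuousW ach.
rewrite ler_norml; apply/andP; split; last first.
  apply: ae_derive_le => //; apply: filterS aeh => c cab /andP[sc ct].
  have [|l lK hl] := cab; first by rewrite (le_trans as_)// (le_trans ct).
  by exists l => //; exact: le_trans (ler_norm _) lK.
rewrite lerNl; have -> : - (h t - h s) = (- h t) - (- h s) by ring.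
apply: (ae_derive_le K0 st (real_abs_continuousN ach')).
apply: filterS aeh => c cab /andP[sc ct].
have [|l lK hl] := cab; first by rewrite (le_trans as_)// (le_trans ct).
exists (- l); last exact: is_deriveN.
by rewrite -normrN in lK; exact: le_trans (ler_norm _) lK.
Qed.

(** A function that cannot increase while above the level [c] stays below it. *)
Lemma barrier a b h c : real_abs_continuous a b h -> h a <= c ->
  (forall s t, a <= s -> s <= t -> t <= b ->
    (forall r, s <= r <= t -> c <= h r) -> h t <= h s) ->
  forall t, a <= t <= b -> h t <= c.
Proof.
move=> ach hac Hdec t /andP[at_ tb]; rewrite leNgt; apply/negP => cht.
pose S := [set s | a <= s <= t /\ h s <= c].
have Sa : S a by split => //; rewrite lexx.
have hS : has_sup S by split; [exists a|exists t => x [/andP[]]].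
pose s0 := sup S.
have as0 : a <= s0 by exact: ub_le_sup hS.2 _ Sa.
have s0t : s0 <= t by apply: ge_sup; [exists a|move=> x [/andP[]]].
have s0ab : a <= s0 <= b by rewrite as0 (le_trans s0t).
have above r : s0 < r -> r <= t -> c < h r.
  move=> s0r rt; rewrite ltNge; apply/negP => hrc.
  have : r <= s0 by apply: ub_le_sup hS.2 _ _; split; rewrite // rt andbT (le_trans as0)// ltW.
  by rewrite leNgt s0r.
have hs0 : h s0 <= c.
  rewrite leNgt; apply/negP; rewrite -subr_gt0 => lt.
  have [d d0 dP] := real_abs_continuous_dist ach lt.
  have [s [/andP[as_ st] hsc] s0s] := sup_adherent d0 hS.
  have ss0 : s <= s0 by apply: ub_le_sup hS.2 _ _; split => //; rewrite as_.
  have : `|h s - h s0| < h s0 - c.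
    apply: dP => //; first by rewrite as_ (le_trans st).
    by rewrite ler0_norm ?subr_le0// opprB ltrBlDl -ltrBlDr.
  by rewrite ltr_norml => /andP[]; lra.
have s0ltt : s0 < t.
  by rewrite lt_neqAle s0t andbT; apply/eqP => E; move: cht; rewrite -E ltNge hs0.
have chs0 : c <= h s0.
  rewrite leNgt; apply/negP; rewrite -subr_gt0 => lt.
  have [d d0 dP] := real_abs_continuous_dist ach lt.
  pose r := Num.min t (s0 + d / 2).
  have s0r : s0 < r by rewrite lt_min s0ltt ltrDl divr_gt0.
  have rt : r <= t by rewrite ge_min lexx.
  have : `|h r - h s0| < c - h s0.
    apply: dP => //; first by rewrite (le_trans as0 (ltW s0r)) (le_trans rt).
    rewrite gtr0_norm ?subr_gt0// ltrBlDl gt_min ltrD2l.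
    by rewrite ltr_pdivrMr// ltr_pMr// ltr1n orbT.
  by have := above r s0r rt; rewrite ltr_norml => ? /andP[]; lra.
have : h t <= h s0.
  apply: Hdec => // r /andP[]; rewrite le_eqVlt => /predU1P[<-//|s0r] rt.
  exact/ltW/above.
by move=> hts0; have := le_trans hts0 hs0; rewrite leNgt cht.
Qed.

(** Bootstrap: a bound [B] that always improves to the smaller bound [c] cannot
    be violated. *)
Lemma bootstrap h (c B : R) :
  (forall T, 0 <= T -> real_abs_continuous 0 T h) -> h 0 <= c -> c < B ->
  (forall T, 0 <= T -> (forall t, 0 <= t <= T -> h t <= B) ->
    forall t, 0 <= t <= T -> h t <= c) ->
  forall t, 0 <= t -> h t <= c.
Proof.
move=> ach h0c cB Himp T T0.
pose P s t := (forall r, 0 <= r <= s -> h r <= c) -> forall r, 0 <= r <= t -> h r <= c.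
suff : P 0 T.
  apply; last by rewrite T0 lexx.
  by move=> r r0; have -> : r = 0 by apply/eqP; rewrite eq_le andbC.
apply: cousin => //; first by move=> s t u _ _ _ _ Pst Ptu Hs; exact/Ptu/Pst.
move=> r /andP[r0 rT]; rewrite -subr_gt0 in cB.
have [d d0 dP] := real_abs_continuous_dist (ach T T0) cB.
exists (d / 2); first by rewrite divr_gt0.
move=> s t s0 sr rt tT rs tr Hs; apply: Himp; first exact: le_trans (le_trans s0 sr) rt.
move=> u /andP[u0 ut]; have [us|/ltW su] := leP u s.
  by have := Hs u; rewrite u0 us => /(_ isT); move: cB; lra.
have : `|h u - h s| < B - c.
  apply: dP; first by rewrite u0 (le_trans ut).
    by rewrite s0 (le_trans su)// (le_trans ut).
  rewrite ger0_norm ?subr_ge0//; lra.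
have := Hs s; rewrite s0 lexx => /(_ isT) hsc.
by rewrite ltr_norml => /andP[_]; lra.
Qed.

End AbsoluteContinuityTheory.

(** * Continuously differentiable functions of several variables *)

Section C1.
Context {R : realType} {m : nat}.
Implicit Types (x y z c : 'rV[R]_m).

Lemma is_derive_line (phi : 'rV[R]_m -> R) x v (h : R) :
  (forall y, derivable phi y v) ->
  is_derive h 1 (fun s => phi (s *: v + x)) ('D_v phi (h *: v + x)).
Proof.
move=> dphi.
have E : (fun e : R => e^-1 *: (phi ((e *: 1 + h) *: v + x) - phi (h *: v + x))) =
         (fun e : R => e^-1 *: (phi (e *: v + (h *: v + x)) - phi (h *: v + x))).
  by apply/funext => e; rewrite [e *: 1]mulr1 scalerDl addrA.
by split; rewrite /derivable /derive E//; exact: dphi.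
Qed.

Lemma line_increment (phi : 'rV[R]_m -> R) x v (p M s t : R) :
  (forall y, derivable phi y v) -> s <= t ->
  (forall h, s <= h <= t -> `|'D_v phi (h *: v + x) - p| <= M) ->
  `|phi (t *: v + x) - phi (s *: v + x) - p * (t - s)| <= M * (t - s).
Proof.
move=> dphi st HM.
have dline (h : R) : is_derive h 1 (fun h => phi (h *: v + x)) ('D_v phi (h *: v + x)).
  exact: is_derive_line.
have cline : {within `[s, t], continuous (fun h => phi (h *: v + x))}.
  by apply: derivable_within_continuous => h _; exact: ex_derive.
have [h] := MVT_segment st (fun h _ => dline h) cline.
rewrite in_itv/= => sht ->; rewrite -mulrBl normrM [`|t - s|]ger0_norm ?subr_ge0//.
by apply: ler_wpM2r; rewrite ?subr_ge0//; exact: HM.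
Qed.

(** The increment of a function whose partial derivatives are [M]-close to
    [p] on a box: the coordinates are changed one at a time. *)
Lemma box_increment (phi : 'rV[R]_m -> R) c (r M : R) (p : 'I_m -> R) :
  (forall j x, derivable phi x (delta_mx 0 j)) ->
  (forall x, `|x - c| <= r -> forall j, `|partial j phi x - p j| <= M) ->
  forall y z, `|y - c| <= r -> `|z - c| <= r ->
  `|phi y - phi z - \sum_j p j * (y 0 j - z 0 j)| <= M * \sum_j `|y 0 j - z 0 j|.
Proof.
move=> dphi HM y z yr zr.
pose w k : 'rV[R]_m := \row_j (if (j < k)%N then y 0 j else z 0 j).
have r0 : 0 <= r by exact: le_trans yr.
have -> : phi y - phi z = \sum_(k < m) (phi (w k.+1) - phi (w k)).
  rewrite -(big_mkord xpredT (fun k => phi (w k.+1) - phi (w k))) telescope_sumr//.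
  by congr (phi _ - phi _); apply/rowP => j; rewrite mxE// ltn_ord.
rewrite -sumrB mulr_sumr; apply: le_trans (ler_norm_sum _ _ _) _.
apply: ler_sum => k _; set b := y 0 k - z 0 k.
have wE : w k.+1 = b *: delta_mx 0 k + w k.
  apply/rowP => j; rewrite !mxE ltnS eqxx/= -val_eqE/=.
  case: ltngtP => [_|_|/val_inj jk]; rewrite ?mulr0 ?add0r//.
  by move: jk => ->; rewrite mulr1 subrK.
have w0 : w k = 0 *: delta_mx 0 k + w k by rewrite scale0r add0r.
have inbox h : Num.min 0 b <= h <= Num.max 0 b -> `|h *: delta_mx 0 k + w k - c| <= r.
  move=> hb; apply: mx_norm_leP => // i j; rewrite ord1 {i} !mxE eqxx/=.
  have := le_coord_mx_norm (y - c) 0 j; have := le_coord_mx_norm (z - c) 0 j.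
  rewrite !mxE => /le_trans/(_ zr) zj /le_trans/(_ yr) yj.
  have [jk|jk] := eqVneq j k; last first.
    by rewrite mulr0 add0r; case: ifP.
  subst j; move: yj zj; rewrite ltnn mulr1 !ler_norml => /andP[y1 y2] /andP[z1 z2].
  move: hb; rewrite /b; have [b0|b0] := leP 0 (y 0 k - z 0 k) => /andP[h1 h2];
    by apply/andP; split; lra.
rewrite wE [in phi (w k)]w0.
have [b0|b0] := leP 0 b.
  have := @line_increment phi (w k) (delta_mx 0 k) (p k) M 0 b (dphi k) b0.
  rewrite subr0 (ger0_norm b0); apply => h hb; apply: HM; apply: inbox.
  by rewrite (min_l b0) (max_r b0).
have := @line_increment phi (w k) (delta_mx 0 k) (p k) M b 0 (dphi k) (ltW b0).
rewrite sub0r (ltr0_norm b0).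
set u := phi _; set u' := phi _.
have -> : u' - u - p k * b = - (u - u' - p k * - b) by ring.
rewrite normrN; apply => h hb; apply: HM; apply: inbox.
by rewrite (min_r (ltW b0)) (max_l (ltW b0)).
Qed.

End C1.

Section C1Consequences.
Context {R : realType} {m : nat}.
Implicit Types (x y z c : 'rV[R]_m) (phi : 'rV[R]_m -> R).

Lemma Ck_S (V : normedModType R) k (f : 'rV[R]_m -> V) : Ck k.+1 f -> Ck k f.
Proof.
elim: k f => [|k IHk] f [cf df]; first exact: cf.
by split=> // j; have [fj cfj] := df j; split => //; exact: IHk.
Qed.

Lemma continuous_box_bounded phi c (r : R) : continuous phi ->
  exists2 M, 0 <= M & forall x, `|x - c| <= r -> `|phi x| <= M.
Proof.
move=> cphi; have [r0|r0] := ltP r 0.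
  by exists 0 => // x /(le_trans (normr_ge0 _)); rewrite leNgt r0.
pose A := [set v : 'rV[R]_m | forall i, `[c 0 i - r, c 0 i + r]%classic (v ord0 i)].
have cA : compact A.
  apply: (@rV_compact R m (fun i => `[c 0 i - r, c 0 i + r]%classic)) => i.
  exact: segment_compact.
have A0 : A !=set0.
  by exists c => i /=; rewrite in_itv/= gerBl r0 lerDl r0.
have cn : {within A, continuous (fun x => `|phi x|)}.
  apply: continuous_subspaceT => x; apply: continuous_comp; first exact: cphi.
  exact: norm_continuous.
have [a _ amax] := EVT_max_rV A0 cA cn.
exists `|phi a| => // x xr; apply: amax; rewrite inE => i /=.
have := le_trans (le_coord_mx_norm (x - c) 0 i) xr.
by rewrite !mxE in_itv/= ler_distl.
Qed.

(** A [C^1] function is Lipschitz on every box. *)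
Lemma C1_box_lipschitz phi c (r : R) : Ck 1 phi ->
  exists2 L, 0 <= L & forall y z, `|y - c| <= r -> `|z - c| <= r ->
    `|phi y - phi z| <= L * `|y - z|.
Proof.
move=> [cphi dphi].
have /choice[M MP] j : exists M, 0 <= M /\
    forall x, `|x - c| <= r -> `|partial j phi x| <= M.
  by have [M M0 MP] := continuous_box_bounded c r (dphi j).2; exists M.
pose M' := \sum_j M j.
have M'0 : 0 <= M' by apply: sumr_ge0 => j _; exact: (MP j).1.
exists (M' * m%:R); first by rewrite mulr_ge0.
move=> y z yr zr.
have := @box_increment R m phi c r M' (fun=> 0) (fun j => (dphi j).1) _ y z yr zr.
rewrite [X in _ - X]big1 ?subr0; last by move=> j _; rewrite mul0r.
move=> H; apply: le_trans (H _) _ => [x xr j|].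
  rewrite subr0; apply: le_trans ((MP j).2 x xr) _.
  by rewrite /M' (bigD1 j)//= lerDl; apply: sumr_ge0 => k _; exact: (MP k).1.
rewrite -mulrA; apply: ler_wpM2l => //.
have -> : m%:R * `|y - z| = \sum_(j < m) `|y - z| by rewrite sumr_const card_ord mulr_natl.
apply: ler_sum => j _.
by have := le_coord_mx_norm (y - z) 0 j; rewrite !mxE.
Qed.

Lemma Ck1_coord (f : 'rV[R]_m -> 'rV[R]_m) i : Ck 1 f -> Ck 1 (fun x => f x 0 i).
Proof.
move=> [cf df]; split.
  move=> x; apply: (@continuous_comp _ _ _ f (fun M : 'rV[R]_m => M 0 i)).
    exact: cf.
  exact: coord_continuous.
move=> j; have [dj cj] := df j; split.
  by move=> x; have /derivable_mxP := dj x; exact.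
rewrite (_ : partial j _ = (fun M : 'rV[R]_m => M 0 i) \o partial j f).
  move=> x; apply: (@continuous_comp _ _ _ (partial j f) (fun M : 'rV[R]_m => M 0 i)).
    exact: cj.
  exact: coord_continuous.
by apply/funext => x; rewrite /partial/= derive_mx// mxE.
Qed.

Lemma C1_box_lipschitz_vec (f : 'rV[R]_m -> 'rV[R]_m) c (r : R) : Ck 1 f ->
  exists2 L, 0 <= L & forall y z, `|y - c| <= r -> `|z - c| <= r ->
    `|f y - f z| <= L * `|y - z|.
Proof.
move=> Cf.
have /choice[L LP] i : exists L, 0 <= L /\ forall y z, `|y - c| <= r ->
    `|z - c| <= r -> `|f y 0 i - f z 0 i| <= L * `|y - z|.
  by have [L L0 LP] := C1_box_lipschitz c r (Ck1_coord i Cf); exists L.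
have L0 i : 0 <= L i by exact: (LP i).1.
exists (\sum_i L i); first by apply: sumr_ge0.
move=> y z yr zr; apply: mx_norm_leP => [|k i].
  by rewrite mulr_ge0// sumr_ge0.
rewrite ord1 !mxE; apply: le_trans ((LP i).2 y z yr zr) _.
by rewrite ler_wpM2r// (bigD1 i)//= lerDl sumr_ge0.
Qed.

(** [grad phi y] is the differential of a [C^1] function at [y]. *)
Lemma C1_grad_approx phi y (e : R) : Ck 1 phi -> 0 < e ->
  exists2 d, 0 < d & forall z, `|z - y| <= d ->
    `|phi z - phi y - mdot (grad phi y) (z - y)| <= e * \sum_j `|z 0 j - y 0 j|.
Proof.
move=> [cphi dphi] e0.
have near_j j : \forall x \near nbhs y, `|partial j phi x - partial j phi y| <= e.
  have /cvgrPdist_le/(_ _ e0) := (dphi j).2 y.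
  by apply: filterS => x; rewrite distrC.
have /nbhs_ballP[d /= d0 dP] := filter_forall (nbhs_filter y) near_j.
exists (d / 2); first by rewrite divr_gt0.
move=> z zd.
have dd : d / 2 < d by rewrite ltr_pdivrMr// ltr_pMr// ltr1n.
have := @box_increment R m phi y (d / 2) e (fun j => partial j phi y)
   (fun j => (dphi j).1) _ z y zd.
rewrite subrr normr0 ler_pdivlMr// mul0r => H.
rewrite /mdot big_ord1 (eq_bigr (fun j => partial j phi y * (z 0 j - y 0 j))); last first.
  by move=> j _; rewrite !mxE.
apply: H (ltW d0) => x xd j; apply: dP.
by rewrite -ball_normE/= distrC (le_lt_trans xd).
Qed.

(** The first-order characterization of strong convexity. *)
Lemma strongly_convex_grad phi (mu : R) y z : 0 < mu -> Ck 1 phi ->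
  strongly_convex mu phi ->
  mdot (grad phi y) (z - y) + mu / 2 * enorm (z - y) ^+ 2 <= phi z - phi y.
Proof.
move=> mu0 Cphi scphi; apply/ler_addgt0Pr => e e0.
set N := enorm _ ^+ 2; set g := mdot _ _.
have N0 : 0 <= N by exact: sqr_ge0.
set S := \sum_j `|z 0 j - y 0 j|.
have S0 : 0 <= S by apply: sumr_ge0.
have eS0 : 0 < e / 2 / (S + 1) by rewrite !divr_gt0// ltr_wpDl.
have [d d0 dP] := C1_grad_approx y Cphi eS0.
(* The step [th] along the segment is so small that the first-order expansion
   holds up to [e / 2] and the factor [1 - th] of the modulus costs at most
   another [e / 2]. *)
pose th := Num.min 1 (Num.min (d / (`|z - y| + 1)) (e / (mu * N + 1))).
have zy0 : 0 < `|z - y| + 1 by rewrite ltr_wpDl.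
have muN : 0 < mu * N + 1 by rewrite ltr_wpDl// mulr_ge0// ltW.
have th0 : 0 < th by rewrite !lt_min ltr01 !divr_gt0.
have th1 : th <= 1 by rewrite ge_min lexx.
have thd : th * `|z - y| <= d.
  have : th <= d / (`|z - y| + 1) by rewrite !ge_min lexx orbT.
  rewrite ler_pdivlMr//; apply: le_trans.
  by rewrite ler_wpM2l ?lerDl// ltW.
have thN : th * (mu * N) <= e.
  have : th <= e / (mu * N + 1) by rewrite !ge_min lexx !orbT.
  rewrite ler_pdivlMr//; apply: le_trans.
  by rewrite ler_wpM2l ?lerDl// ltW.
have := scphi z y th; rewrite (ltW th0) th1 => /(_ isT).
set w := th *: z + (1 - th) *: y; rewrite -/N => conv.
have wE : w - y = th *: (z - y).
  by apply/rowP => j; rewrite !mxE; ring.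
have := dP w; rewrite wE normrZ (gtr0_norm th0) => /(_ thd).
rewrite mdotZr -/g (eq_bigr (fun j => th * `|z 0 j - y 0 j|)); last first.
  move=> j _; have /rowP/(_ j) := wE; rewrite !mxE => ->.
  by rewrite normrM gtr0_norm.
rewrite -mulr_sumr -/S => /ler_normlP[+ _].
have : e / 2 / (S + 1) * (th * S) <= th * (e / 2).
  rewrite mulrCA; apply: ler_wpM2l; first exact: ltW.
  by rewrite mulrAC ler_pdivrMr ?ltr_wpDl// ler_wpM2l ?lerDl// divr_ge0// ltW.
move=> h1 h2.
have : th * (g + mu / 2 * N - mu / 2 * th * N) <= th * (phi z - phi y + e / 2).
  lra.
rewrite ler_pM2l//; lra.
Qed.

Lemma strongly_convex_coercive phi (mu : R) y c : 0 < mu -> Ck 1 phi ->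
  strongly_convex mu phi ->
  mu * enorm (y - c) ^+ 2 - enorm (grad phi c) * enorm (y - c) <=
    mdot (y - c) (grad phi y).
Proof.
move=> mu0 Cphi scphi.
have := strongly_convex_grad y c mu0 Cphi scphi.
have := strongly_convex_grad c y mu0 Cphi scphi.
rewrite -(opprB y c) enormN mdotNr (mdotC (grad phi y)).
have : - mdot (grad phi c) (y - c) <= enorm (grad phi c) * enorm (y - c).
  by rewrite -mdotNr -(enormN (y - c)) mdot_le_enorm.
lra.
Qed.

End C1Consequences.

(** * Primitives of bounded measurable functions *)

Section Primitive.
Context {R : realType}.
Implicit Types (f g : R -> R) (s t C : R).
Local Notation mu := (@lebesgue_measure R).

(** Bounded measurable functions on the line, for which [primitive] is
    unconditionally well behaved. *)
Definition bounded_measurable f : Prop :=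
  measurable_fun [set: R] f /\ exists K, forall s, `|f s| <= K.

(** The primitive [t |-> \int_0^t f], used for [0 <= t] only. *)
Definition primitive f t : R := \int[mu]_(s in `[0, t]) f s.

Lemma bounded_measurable_integrable f (I : interval R) :
  bounded_measurable f -> (mu [set` I] < +oo)%E ->
  mu.-integrable [set` I] (EFin \o f).
Proof.
move=> [mf [K fK]] muI; apply: measurable_bounded_integrable => //.
  exact: measurable_funTS.
by exists K; split; [exact: num_real|move=> M KM s _; exact: le_trans (fK s) (ltW KM)].
Qed.

Lemma bounded_measurableB f g : bounded_measurable f -> bounded_measurable g ->
  bounded_measurable (fun s => f s - g s).
Proof.
move=> [mf [K fK]] [mg [L gL]]; split; first exact: measurable_funB.
by exists (K + L) => s; apply: le_trans (ler_normB _ _) _; exact: lerD.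
Qed.

Lemma mu_itv_lty (b1 b2 : bool) s t :
  (mu [set` Interval (BSide b1 s) (BSide b2 t)] < +oo)%E.
Proof.
by rewrite lebesgue_measure_itv/=; case: ifP => // _; rewrite ltry.
Qed.

Lemma primitive0 f : primitive f 0 = 0.
Proof. by rewrite /primitive set_itv1 Rintegral_set1. Qed.

Lemma eq_primitive f g t : (forall s, 0 <= s <= t -> f s = g s) ->
  primitive f t = primitive g t.
Proof. by move=> fg; apply: eq_Rintegral => s; rewrite inE/= in_itv/=; exact: fg. Qed.

Lemma primitiveB f g t : bounded_measurable f -> bounded_measurable g ->
  primitive (fun s => f s - g s) t = primitive f t - primitive g t.
Proof.
move=> bf bg; apply: RintegralB => //.
  exact: bounded_measurable_integrable bf (mu_itv_lty _ _ _ _).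
exact: bounded_measurable_integrable bg (mu_itv_lty _ _ _ _).
Qed.

Lemma primitive_dist_le f s t C : bounded_measurable f -> 0 <= s -> s <= t ->
  (forall r, s < r <= t -> `|f r| <= C) ->
  `|primitive f t - primitive f s| <= C * (t - s).
Proof.
move=> bf s0 st fC.
rewrite /primitive Rintegral_itvB ?bnd_simp//; last first.
  exact: bounded_measurable_integrable bf (mu_itv_lty _ _ _ _).
have fint : mu.-integrable `]s, t] (EFin \o f).
  exact: bounded_measurable_integrable bf (mu_itv_lty _ _ _ _).
apply: le_trans (le_normr_Rintegral _ fint) _ => //.
have -> : C * (t - s) = \int[mu]_(x in `]s, t]) C.
  rewrite Rintegral_cst//; congr (_ * _).
  by rewrite [X in fine X](lebesgue_measure_oc st).
apply: le_Rintegral => //.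
- exact: integrable_norm fint.
- apply: (@bounded_measurable_integrable (fun=> C) `]s, t]) (mu_itv_lty _ _ _ _).
  by split; [exact: measurable_cst|exists `|C|].
Qed.

(** Lebesgue's differentiation theorem for the primitive. *)
Lemma primitive_is_derive f : bounded_measurable f ->
  {ae mu, forall t, 0 <= t -> is_derive t 1 (primitive f) (f t)}.
Proof.
move=> bf.
have lf : locally_integrable [set: R] f.
  split; [exact: bf.1|exact: openT|move=> K _ cK].
  have mK : measurable K by exact: compact_measurable.
  have [K' fK'] := bf.2.
  have /integrableP[_] : mu.-integrable K (EFin \o f).
    apply: measurable_bounded_integrable => //.
    - exact: compact_finite_measure.
    - exact: measurable_funTS bf.1.
    - by exists K'; split; [exact: num_real|move=> M KM s _; exact: le_trans (fK' s) (ltW KM)].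
  by [].
have intf y : mu.-integrable [set` Interval (BLeft 0) (BRight y)] (EFin \o f).
  exact: bounded_measurable_integrable bf (mu_itv_lty _ _ _ _).
have t0 : {ae mu, forall t, t != 0}.
  exists [set 0]; split => //=; first exact: lebesgue_measure_set1.
  by move=> t /= /negP; rewrite negbK => /eqP.
have := FTC1 intf lf; apply: filterS2 t0 => t tn0 H t0.
have [|dF Fd] := H; first by rewrite /= lte_fin lt_def tn0.
by split; [exact: dF|rewrite -derive1E].
Qed.

End Primitive.

(** * Integral equations with a delay *)

Section VectorPrimitive.
Context {R : realType} {n m : nat}.
Local Notation V := 'M[R]_(n, m).
Implicit Types (u v : R -> V) (s t C : R).

(** Entrywise versions of [bounded_measurable] and [primitive]. *)
Definition bounded_measurable_mx u : Prop :=
  forall i j, bounded_measurable (fun s => u s i j).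

Definition primitive_mx u t : V := \matrix_(i, j) primitive (fun s => u s i j) t.

Lemma eq_primitive_mx u v t : (forall s, 0 <= s <= t -> u s = v s) ->
  primitive_mx u t = primitive_mx v t.
Proof.
by move=> uv; apply/matrixP => i j; rewrite !mxE; apply: eq_primitive => s /uv ->.
Qed.

Lemma primitive_mx0 u : primitive_mx u 0 = 0.
Proof. by apply/matrixP => i j; rewrite !mxE primitive0. Qed.

Lemma primitive_mx_dist_le u s t C : bounded_measurable_mx u -> 0 <= C ->
  0 <= s -> s <= t -> (forall r, s < r <= t -> `|u r| <= C) ->
  `|primitive_mx u t - primitive_mx u s| <= C * (t - s).
Proof.
move=> bu C0 s0 st uC; apply: mx_norm_leP => [|i j].
  by rewrite mulr_ge0// subr_ge0.
rewrite !mxE; apply: primitive_dist_le => // r /uC; apply: le_trans.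
exact: le_coord_mx_norm.
Qed.

Lemma primitive_mxB u v t : bounded_measurable_mx u -> bounded_measurable_mx v ->
  primitive_mx (fun s => u s - v s) t = primitive_mx u t - primitive_mx v t.
Proof.
move=> bu bv; apply/matrixP => i j; rewrite !mxE -primitiveB//.
by apply: eq_primitive => s _; rewrite !mxE.
Qed.

Lemma primitive_mx_contract u v s t C : bounded_measurable_mx u ->
  bounded_measurable_mx v -> 0 <= C ->
  0 <= s -> s <= t -> (forall r, s < r <= t -> `|u r - v r| <= C) ->
  `|(primitive_mx u t - primitive_mx u s) -
    (primitive_mx v t - primitive_mx v s)| <= C * (t - s).
Proof.
move=> bu bv C0 s0 st uvC.
have regroup (A B A' B' : V) : A - B - (A' - B') = (A - A') - (B - B').
  by rewrite !opprD addrACA.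
rewrite regroup -(primitive_mxB t bu bv) -(primitive_mxB s bu bv).
apply: primitive_mx_dist_le => // i j.
have [mB [K KB]] := bounded_measurableB (bu i j) (bv i j); split.
  by apply: eq_measurable_fun mB => s' _; rewrite !mxE.
by exists K => s'; rewrite !mxE.
Qed.

End VectorPrimitive.

Section GeometricLimit.
Context {R : realType}.

Lemma geometric_small (A e : R) : 0 < e -> exists k, A / 2 ^+ k <= e.
Proof.
move=> e0; have [k Ak] : exists k : nat, A / e <= k%:R.
  exists (Num.truncn (A / e)).+1; apply: ltW.
  exact: truncnS_gt.
exists k; rewrite ler_pdivrMr ?exprn_gt0// mulrC -ler_pdivrMr//.
apply: le_trans Ak _; rewrite -natrX ler_nat.
exact/ltnW/ltn_expl.
Qed.

Lemma geometric_le0 (A x : R) : (forall k, x <= A / 2 ^+ k) -> x <= 0.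
Proof.
move=> H; apply/ler_addgt0Pr => e e0; rewrite add0r.
have [k Ak] := geometric_small A e0; exact: le_trans (H k) Ak.
Qed.

Lemma geometric_limit (u : nat -> R) (C : R) :
  (forall k, `|u k.+1 - u k| <= C / 2 ^+ k) ->
  exists l, forall k, `|l - u k| <= C *+ 2 / 2 ^+ k.
Proof.
move=> uC; pose a k := C *+ 2 / 2 ^+ k.
have aS k : a k - a k.+1 = C / 2 ^+ k.
  rewrite /a exprS invfM mulr2n; field.
  by rewrite expf_neq0.
have mono k p : u k - a k <= u (k + p)%N - a (k + p)%N.
  elim: p => [|p IHp]; first by rewrite addn0.
  apply: le_trans IHp _; rewrite addnS.
  have := uC (k + p)%N; rewrite -aS ler_norml => /andP[]; lra.
have anti k p : u (k + p)%N + a (k + p)%N <= u k + a k.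
  elim: p => [|p IHp]; first by rewrite addn0.
  apply: le_trans IHp; rewrite addnS.
  have := uC (k + p)%N; rewrite -aS ler_norml => /andP[]; lra.
have C0 : 0 <= C.
  have := uC 0%N; rewrite expr0 divr1; exact: le_trans.
have a0 k : 0 <= a k by rewrite divr_ge0 ?mulrn_wge0// exprn_ge0.
have sep k p : u k - a k <= u p + a p.
  apply: le_trans (mono k p) _; rewrite addnC; apply: le_trans (anti p k).
  by have := a0 (p + k)%N; lra.
pose S := range (fun k => u k - a k).
exists (sup S) => k; rewrite ler_distl; apply/andP; split.
  apply: ub_le_sup; last by exists k.
  by exists (u 0%N + a 0%N) => _ [p _ <-].
by apply: ge_sup; [exists (u 0%N - a 0%N); exists 0%N|move=> _ [p _ <-]].
Qed.

End GeometricLimit.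

Lemma lipschitz_path_continuous (R : realType) (W : normedModType R) (u : R -> W) (K : R) :
  0 <= K -> (forall s t, s <= t -> `|u t - u s| <= K * (t - s)) -> continuous u.
Proof.
move=> K0 uK t; apply/cvgrPdist_le => /= e e0.
have K1 : 0 < K + 1 by rewrite ltr_wpDl.
apply/nbhs_ballP; exists (e / (K + 1)) => /=; first exact: divr_gt0.
move=> s /= ts; have {}ts : `|t - s| < e / (K + 1) := ts.
have key : `|u t - u s| <= K * `|t - s|.
  have [st|/ltW ts'] := leP s t; first by rewrite ger0_norm ?subr_ge0// uK.
  by rewrite distrC (distrC t) ger0_norm ?subr_ge0// uK.
apply: le_trans key _; rewrite ltr_pdivlMr// mulrC in ts.
by apply: le_trans (ltW ts); rewrite ler_wpM2r// lerDl.
Qed.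

Lemma continuous_minr (R : realType) (c : R) : continuous (fun t : R => Num.min t c).
Proof.
apply: (@lipschitz_path_continuous R R^o _ 1) => // s t st; rewrite mul1r.
rewrite ger0_norm; last by rewrite subr_ge0 le_min2.
by rewrite !minEle; case: (leP s c) => ?; case: (leP t c) => ?; lra.
Qed.

(** The delayed equation in integral form, for a field [F] that is globally
    bounded, globally Lipschitz in the current state, and merely measurable
    along continuous paths. *)
Section DelayIntegralEquation.
Context {R : realType} {n m : nat}.
Local Notation V := 'M[R]_(n, m).
Variables (F : V -> V -> V) (K L : R).
Hypothesis K0 : 0 <= K.
Hypothesis L0 : 0 <= L.
Hypothesis F_bounded : forall X Y, `|F X Y| <= K.
Hypothesis F_lipschitz : forall X X' Y, `|F X Y - F X' Y| <= L * `|X - X'|.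
Hypothesis F_measurable : forall X Y : R -> V, continuous X -> continuous Y ->
  forall i j, measurable_fun [set: R] (fun t => F (X t) (Y t) i j).

Let F_bm (X Y : R -> V) : continuous X -> continuous Y ->
  bounded_measurable_mx (fun s => F (X s) (Y s)).
Proof.
move=> cX cY i j; split; first exact: F_measurable.
by exists K => s; exact: le_trans (le_coord_mx_norm _ _ _) (F_bounded _ _).
Qed.


Section Step.
Variables (X Y : R -> V) (t0 d : R).
Hypotheses (cX : continuous X) (cY : continuous Y) (t0_ge0 : 0 <= t0).
Hypotheses (d0 : 0 <= d) (Ld : L * d <= 1 / 2).

Let P (Z : R -> V) t : V := primitive_mx (fun s => F (Z s) (Y s)) t.

(* The Picard operator, extended by the past [X] to the left of [t0]. *)
Let picard (Z : R -> V) t : V :=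
  X (Num.min t t0) + (P Z (Num.max t t0) - P Z t0).

Let picard_continuous Z : continuous Z -> continuous (picard Z).
Proof.
move=> cZ t; apply: (@cvgD _ V).
  apply: (@continuous_comp _ _ _ (fun t => Num.min t t0) X); last exact: cX.
  exact: continuous_minr.
move: t; apply: (@lipschitz_path_continuous R V _ K K0) => s t st.
rewrite opprB addrA subrK.
apply: le_trans (@primitive_mx_dist_le _ _ _ _ _ _ K _ K0 _ _ _) _ => //.
- exact: F_bm.
- by rewrite le_max t0_ge0 orbT.
- by rewrite le_max2.
apply: ler_wpM2l => //.
by rewrite !maxEle; case: (leP s t0) => ?; case: (leP t t0) => ?; lra.
Qed.

(* Only times [t <= t0 + d] matter for the contraction. *)
Let picard_contract Z Z' (C : R) : continuous Z -> continuous Z' -> 0 <= C ->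
  (forall t, t <= t0 + d -> `|Z t - Z' t| <= C) ->
  forall t, t <= t0 + d -> `|picard Z t - picard Z' t| <= C / 2.
Proof.
move=> cZ cZ' C0 ZC t td; rewrite /picard opprD addrACA subrr add0r.
have LC0 : 0 <= L * C by rewrite mulr_ge0.
apply: le_trans (primitive_mx_contract (F_bm cZ cY) (F_bm cZ' cY) LC0 t0_ge0 _ _) _.
- by rewrite le_max lexx orbT.
- move=> r /andP[_ rt]; apply: le_trans (F_lipschitz _ _ _) _.
  apply: ler_wpM2l => //; apply: ZC; apply: le_trans rt _.
  by rewrite ge_max td lerDl.
have : Num.max t t0 - t0 <= d by rewrite lerBlDl ge_max td lerDl.
move=> /(ler_wpM2l LC0) /le_trans; apply; rewrite mulrAC [leRHS]mulrC.
by rewrite -div1r; apply: ler_wpM2r.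
Qed.

(** One step of the method of steps: the past argument [Y] is known, and a
    Picard iteration solves the integral equation on [[t0, t0 + d]]. *)
Lemma picard_step : exists Z, [/\ continuous Z,
  forall t, t <= t0 -> Z t = X t &
  forall t, t0 <= t -> t <= t0 + d -> Z t = X t0 + (P Z t - P Z t0)].
Proof.
pose Z k := iter k picard (fun t => X (Num.min t t0)).
have cZ k : continuous (Z k).
  elim: k => [|k IHk]; last exact: picard_continuous.
  move=> t; apply: (@continuous_comp _ _ _ (fun t => Num.min t t0) X); last exact: cX.
  exact: continuous_minr.
have C0 : 0 <= K * d by rewrite mulr_ge0.
have ZS k t : t <= t0 + d -> `|Z k.+1 t - Z k t| <= K * d / 2 ^+ k.
  elim: k t => [|k IHk] t td.
    rewrite /Z/= /picard addrC addKr divr1.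
    apply: le_trans (primitive_mx_dist_le (F_bm (cZ 0%N) cY) K0 t0_ge0 _ _) _ => //.
      by rewrite le_max lexx orbT.
    by apply: ler_wpM2l => //; rewrite lerBlDl ge_max td lerDl.
  rewrite exprSr invfM mulrA; apply: (picard_contract (cZ k.+1) (cZ k)) => //.
  by rewrite divr_ge0 ?exprn_ge0.
have /choice[W WP] t : exists W : V, t <= t0 + d -> forall k,
    `|W - Z k t| <= (K * d) *+ 2 / 2 ^+ k.
  have [td|_] := leP t (t0 + d); last by exists 0.
  have /choice[w wP] (ij : 'I_n * 'I_m) : exists l, forall k,
      `|l - Z k t ij.1 ij.2| <= (K * d) *+ 2 / 2 ^+ k.
    apply: geometric_limit => k; apply: le_trans (ZS k t td).
    by have := le_coord_mx_norm (Z k.+1 t - Z k t) ij.1 ij.2; rewrite !mxE.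
  exists (\matrix_(i, j) w (i, j)) => _ k; apply: mx_norm_leP => [|i j].
    by rewrite divr_ge0 ?mulrn_wge0 ?exprn_ge0.
  by rewrite !mxE; exact: (wP (i, j)).
(* Freezing the limit after [t0 + d] makes the convergence uniform on the
   whole line. *)
pose Zf t := W (Num.min t (t0 + d)).
have ZfE t : t <= t0 + d -> forall k, `|Zf t - Z k t| <= (K * d) *+ 2 / 2 ^+ k.
  by move=> td k; rewrite /Zf (min_l td); exact: WP.
have cZf : continuous Zf.
  move=> t; apply/cvgrPdist_le => /= e e0.
  have e30 : 0 < e / 3 by rewrite divr_gt0.
  have [k ke] := geometric_small (K * d *+ 2) e30.
  have ck : continuous (fun t => Z k (Num.min t (t0 + d))).
    move=> u; apply: (@continuous_comp _ _ _ (fun t => Num.min t (t0 + d)) (Z k)).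
      exact: continuous_minr.
    exact: cZ.
  have ZfW u : `|Zf u - Z k (Num.min u (t0 + d))| <= e / 3.
    by apply: le_trans ke; apply: WP; rewrite ge_min lexx orbT.
  have /cvgrPdist_le/(_ _ e30) := ck t; apply: filterS => s ts.
  have -> : Zf t - Zf s = (Zf t - Z k (Num.min t (t0 + d))) +
    (Z k (Num.min t (t0 + d)) - Z k (Num.min s (t0 + d))) -
    (Zf s - Z k (Num.min s (t0 + d))).
    by rewrite addrA subrK opprB addrA subrK.
  apply: le_trans (ler_normB _ _) _.
  have := ler_normD (Zf t - Z k (Num.min t (t0 + d)))
    (Z k (Num.min t (t0 + d)) - Z k (Num.min s (t0 + d))).
  have := ZfW t; have := ZfW s; lra.
have fixZf t : t <= t0 + d -> Zf t = picard Zf t.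
  move=> td; apply/eqP; rewrite -subr_eq0 -normr_le0.
  apply: (@geometric_le0 _ ((K * d) *+ 2)) => k.
  rewrite -(subrK (Z k.+1 t) (Zf t)) -addrA.
  apply: le_trans (ler_normD _ _) _.
  have a0 : 0 <= (K * d) *+ 2 / 2 ^+ k by rewrite divr_ge0 ?mulrn_wge0 ?exprn_ge0.
  have h1 := ZfE t td k.+1.
  have h2 : `|Z k.+1 t - picard Zf t| <= (K * d) *+ 2 / 2 ^+ k / 2.
    by apply: (picard_contract (cZ k) cZf) => // u ud; rewrite distrC; exact: ZfE.
  apply: le_trans (lerD h1 h2) _.
  by rewrite exprSr invfM mulrA -splitr.
exists Zf; split => // t; last first.
  move=> tt0 td; rewrite [LHS](fixZf t td) /picard.
  by rewrite (min_r tt0) (max_l tt0).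
move=> tt0; have td : t <= t0 + d by apply: le_trans tt0 _; rewrite lerDl.
by rewrite fixZf// /picard (min_l tt0) (max_r tt0) subrr addr0.
Qed.

End Step.
Section Global.
Variables (H : R -> V) (d : R).
Hypotheses (cH : continuous H) (d0 : 0 < d) (Ld : L * d <= 1 / 2).

Let rhs (Z : R -> V) t : V := primitive_mx (fun s => F (Z s) (Z (s - d))) t.

Let solves (T : R) (Z : R -> V) : Prop := [/\ continuous Z,
  forall t, t <= 0 -> Z t = H t &
  forall t, 0 <= t -> t <= T -> Z t = H 0 + rhs Z t].

Let delayed_continuous (Z : R -> V) : continuous Z -> continuous (fun s => Z (s - d)).
Proof.
move=> cZ t; apply: (@continuous_comp _ _ _ (fun s => s - d) Z); last exact: cZ.
by apply: cvgB; [exact: cvg_id|exact: cvg_cst].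
Qed.

Let extend k (X : R -> V) : solves (k%:R * d) X ->
  exists Z, solves (k.+1%:R * d) Z /\ forall t, t <= k%:R * d -> Z t = X t.
Proof.
move=> [cX X0 XE].
have kd0 : 0 <= k%:R * d by rewrite mulr_ge0// ltW.
have [Z [cZ ZX ZE]] := picard_step cX (delayed_continuous cX) kd0 (ltW d0) Ld.
exists Z; split => //; split => // t t0.
  by rewrite ZX ?X0// (le_trans t0).
have SE : k.+1%:R * d = k%:R * d + d by rewrite -natr1 mulrDl mul1r.
rewrite SE => td; have same s : s <= k%:R * d + d -> Z (s - d) = X (s - d).
  by move=> sd; rewrite ZX// lerBlDr.
have [tk|/ltW kt] := leP t (k%:R * d).
  rewrite ZX// XE//; congr (_ + _); apply: eq_primitive_mx => s /andP[_ st].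
  by rewrite same ?ZX// (le_trans st).
rewrite ZE// XE// -addrA; congr (_ + _).
have -> : rhs X (k%:R * d) = primitive_mx (fun s => F (Z s) (X (s - d))) (k%:R * d).
  by apply: eq_primitive_mx => s /andP[_ sk]; rewrite ZX.
rewrite addrC subrK; apply: eq_primitive_mx => s /andP[_ st].
by rewrite same// (le_trans st).
Qed.

(** Global solvability of the delayed integral equation, one delay interval
    at a time. *)
Lemma delay_integral_solution : exists X : R -> V, [/\ continuous X,
  forall t, t <= 0 -> X t = H t &
  forall t, 0 <= t -> X t = H 0 + primitive_mx (fun s => F (X s) (X (s - d))) t].
Proof.
pose step (a b : nat * (R -> V)) := b.1 = a.1.+1 /\ (solves (a.1%:R * d) a.2 ->
  solves (b.1%:R * d) b.2 /\ forall t, t <= a.1%:R * d -> b.2 t = a.2 t).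
have [a|G [G0 GS]] := @dependent_choice _ step _ (0%N, H).
  apply: cid; have [/extend[Z ZP]|nS] := pselect (solves (a.1%:R * d) a.2).
    by exists (a.1.+1, Z).
  by exists (a.1.+1, H); split.
have Gidx k : (G k).1 = k by elim: k => [|k IHk]; [rewrite G0|rewrite (GS k).1 IHk].
have Gsol k : solves (k%:R * d) (G k).2.
  elim: k => [|k IHk].
    rewrite G0 mul0r; split => // t t0 t0'.
    have -> : t = 0 by apply/eqP; rewrite eq_le t0 t0'.
    by rewrite /rhs primitive_mx0 addr0.
  by have [_ ] := GS k; rewrite !Gidx => /(_ IHk)[].
have Gext k p (t : R) : t <= k%:R * d -> (G (k + p)%N).2 t = (G k).2 t.
  elim: p => [|p IHp] tk; first by rewrite addn0.
  rewrite addnS -IHp//; have [_] := GS (k + p)%N; rewrite !Gidx.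
  move=> /(_ (Gsol _))[_]; apply; apply: le_trans tk _.
  by rewrite ler_wpM2r ?ler_nat ?leq_addr// ltW.
have /choice[N NP] (t : R) : exists k : nat, t <= k%:R * d.
  exists (Num.truncn (t / d)).+1; rewrite -ler_pdivrMr//; apply: ltW.
  exact: truncnS_gt.
pose X (t : R) : V := (G (N t)).2 t.
have XE k (t : R) : t <= k%:R * d -> X t = (G k).2 t.
  move=> tk; rewrite /X -(Gext (N t) k t (NP t)) addnC.
  exact: Gext.
exists X; split => [t|t t0|t t0].
- have [cG _ _] := Gsol (N (t + 1)).
  have : X @ t --> (G (N (t + 1))).2 t; last first.
    by rewrite -(XE (N (t + 1)))// (le_trans _ (NP _))// lerDl.
  apply: cvg_trans (cG t); apply: near_eq_cvg.
  have t1 : t < t + 1 by rewrite ltrDl.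
  near=> s; apply/esym/XE; apply: le_trans (NP (t + 1)); apply: ltW.
  by near: s; exact: lt_nbhsl.
- have [_ G0' _] := Gsol 0%N.
  by rewrite (XE 0%N) ?mul0r// G0'.
- have [_ _ GE] := Gsol (N t).
  rewrite {1}/X GE//; congr (_ + _); apply: eq_primitive_mx => s /andP[_ st].
  have sN : s <= (N t)%:R * d by exact: le_trans st (NP t).
  by rewrite -!XE// (le_trans _ sN)// gerBl ltW.
Unshelve. all: by end_near. Qed.

End Global.
End DelayIntegralEquation.

(** * Dissipative delay systems *)

(** A function on a segment, extended by constants to the whole line. *)
Lemma within_segment_clamp (R : realType) (W : normedModType R) (a b : R) (h : R -> W) :
  a <= b -> {within `[a, b], continuous h} ->
  continuous (fun t => h (Num.max a (Num.min t b))).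
Proof.
move=> ab ch t; pose cl (s : R) := Num.max a (Num.min s b).
have clP s : `[a, b]%classic (cl s).
  by rewrite /= in_itv/= le_max lexx/= ge_max ab ge_min lexx orbT.
have ccl : continuous cl.
  apply: (@lipschitz_path_continuous R R^o _ 1) => // s u su; rewrite mul1r.
  have mono : Num.min s b <= Num.min u b by rewrite le_min2.
  rewrite ger0_norm; last by rewrite subr_ge0 le_max2.
  have : Num.min u b - Num.min s b <= u - s.
    by rewrite !minEle; case: (leP s b) => ?; case: (leP u b) => ?; lra.
  move: mono; rewrite /cl; set s' := Num.min s b; set u' := Num.min u b.
  by rewrite !maxEle; case: (leP a s') => ?; case: (leP a u') => ?; lra.
apply/cvgrPdist_le => /= e e0.
have /cvgrPdist_le/(_ _ e0) hnear := ch (cl t).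
have : within `[a, b] (nbhs (cl t)) [set s | `|h (cl t) - h s| <= e].
  by rewrite (nbhs_subspace_in (clP t)); exact: hnear.
move=> /(ccl t) clnear.
have : \forall s \near nbhs t, `[a, b]%classic (cl s) -> `|h (cl t) - h (cl s)| <= e.
  exact: clnear.
by apply: filterS => s; apply; exact: clP.
Qed.

Section MatrixPaths.
Context {R : realType} {n m : nat}.
Local Notation V := 'M[R]_(n, m).
Implicit Types (x : R -> V) (c : V).

Lemma enormB_dist (A B : V) : `|enorm A - enorm B| <= enorm (A - B).
Proof.
rewrite ler_norml; apply/andP; split.
  rewrite lerBrDr addrC lerBlDr.
  have := enormD (B - A) A; rewrite subrK -(opprB A) enormN; lra.
by rewrite lerBlDr; have := enormD (A - B) B; rewrite subrK.
Qed.

Lemma is_derive_mdot x c (t : R) (D : V) :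
  (forall i j, is_derive t 1 (fun s => x s i j) (D i j)) ->
  is_derive t 1 (fun s => mdot (x s - c) (x s - c)) (2 * mdot (x t - c) D).
Proof.
move=> dx.
pose h i j : R -> R := (fun s => x s i j) - cst (c i j).
have hE i j s : h i j s = (x s - c) i j by rewrite !mxE.
have dh i j : is_derive t 1 (h i j) (D i j).
  by rewrite -[D i j]subr0; apply: is_deriveB.
have -> : (fun s => mdot (x s - c) (x s - c)) =
    \sum_(i < n) \sum_(j < m) (h i j * h i j).
  apply/funext => s; rewrite fct_sumE; apply: eq_bigr => i _.
  rewrite fct_sumE; apply: eq_bigr => j _.
  by rewrite -!hE.
have -> : 2 * mdot (x t - c) D =
    \sum_(i < n) \sum_(j < m) (h i j t *: D i j + h i j t *: D i j).
  rewrite /mdot mulr_sumr; apply: eq_bigr => i _.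
  rewrite mulr_sumr; apply: eq_bigr => j _.
  by rewrite !hE [_ *: _]mulrC [in RHS]mulrC; ring.
by apply: is_derive_sum => i; apply: is_derive_sum => j.
Qed.

Lemma real_abs_continuous_enorm a b x c : abs_continuous a b x ->
  real_abs_continuous a b (fun t => enorm (x t - c)).
Proof.
move=> acx; apply: (real_abs_continuous_dominated ler01 acx) => u v _ _ _.
rewrite mul1r; apply: le_trans (enormB_dist _ _) _.
by rewrite opprB addrA subrK.
Qed.

Lemma real_abs_continuous_mdot a b x c (B : R) : 0 <= B -> abs_continuous a b x ->
  (forall t, a <= t <= b -> enorm (x t - c) <= B) ->
  real_abs_continuous a b (fun t => mdot (x t - c) (x t - c)).
Proof.
move=> B0 acx xB; have B20 : 0 <= B *+ 2 by rewrite mulrn_wge0.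
apply: (real_abs_continuous_dominated B20 acx) => u v au uv vb.
rewrite -!sqr_enorm subr_sqr normrM mulrC; apply: ler_pM => //.
  rewrite ger0_norm ?addr_ge0 ?enorm_ge0// mulr2n; apply: lerD; apply: xB.
    by rewrite vb (le_trans au).
  by rewrite au (le_trans uv).
apply: le_trans (enormB_dist _ _) _.
by rewrite opprB addrA subrK.
Qed.

Lemma lipschitz_abs_continuous a b x (K : R) : 0 <= K ->
  (forall s t, a <= s -> s <= t -> t <= b -> enorm (x t - x s) <= K * (t - s)) ->
  abs_continuous a b x.
Proof.
move=> K0 xK e e0; have K1 : 0 < K + 1 by rewrite ltr_wpDl.
exists (e / (K + 1)); first exact: divr_gt0.
move=> N u v uv _; rewrite ltr_pdivlMr// mulrC; apply: le_lt_trans.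
rewrite mulr_sumr; apply: ler_sum => k _; have [au ukv vb] := uv k.
apply: le_trans (xK _ _ au ukv vb) _.
by apply: ler_wpM2r; rewrite ?subr_ge0// lerDl.
Qed.

(** The componentwise projection on the box of radius [B] around [c]. *)
Definition clip c (B : R) (X : V) : V :=
  \matrix_(i, j) (c i j + Num.max (- B) (Num.min (X i j - c i j) B)).

Lemma clip_box c B X : 0 <= B -> `|clip c B X - c| <= B.
Proof.
move=> B0; apply: mx_norm_leP => // i j.
rewrite !mxE addrC addKr ler_norml le_max lexx/= ge_max ge_min lexx orbT andbT.
by lra.
Qed.

Lemma clip_id c B X : `|X - c| <= B -> clip c B X = X.
Proof.
move=> XB; apply/matrixP => i j.
have := le_trans (le_coord_mx_norm (X - c) i j) XB.
rewrite !mxE ler_norml => /andP[h1 h2].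
by rewrite (min_l h2) (max_r h1); ring.
Qed.

Lemma clip_dist c B X Y : 0 <= B -> `|clip c B X - clip c B Y| <= `|X - Y|.
Proof.
move=> B0; apply: mx_norm_leP => // i j.
apply: le_trans (le_coord_mx_norm (X - Y) i j).
rewrite !mxE; set p := X i j - c i j; set q := Y i j - c i j.
have -> : X i j - Y i j = p - q by rewrite /p /q opprB addrA subrK.
rewrite opprD addrACA subrr add0r.
wlog pq : p q / p <= q.
  by move=> W; have [/W//|/ltW/W] := leP p q; rewrite distrC (distrC q).
have h1 : Num.min p B <= Num.min q B by rewrite le_min2.
have h2 : Num.min q B - Num.min p B <= q - p.
  by rewrite !minEle; case: (leP p B) => ?; case: (leP q B) => ?; lra.
rewrite distrC (distrC p) !ger0_norm ?subr_ge0 ?le_max2//.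
move: h1 h2; set p' := Num.min p B; set q' := Num.min q B.
by rewrite !maxEle; case: (leP (- B) p') => ?; case: (leP (- B) q') => ?; lra.
Qed.

Lemma clip_continuous c B x : 0 <= B -> continuous x ->
  continuous (fun t => clip c B (x t)).
Proof.
move=> B0 cx t; apply/cvgrPdist_le => /= e e0.
have /cvgrPdist_le/(_ _ e0) := cx t; apply: filterS => s; apply: le_trans.
exact: clip_dist.
Qed.

End MatrixPaths.

Section DelaySystem.
Context {R : realType} {n m : nat}.
Local Notation V := 'M[R]_(n, m).
Local Notation mu := (@lebesgue_measure R).

(** Caratheodory solutions of [x'(t) = F (x t) (x (t - d))] with history [h]. *)
Definition delay_solution (F : V -> V -> V) (d : R) (h x : R -> V) : Prop :=
  [/\ forall s, - d <= s <= 0 -> x s = h s,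
      forall T, 0 <= T -> abs_continuous 0 T x &
      {ae mu, forall t : R, 0 <= t -> forall i j,
        is_derive t 1 (fun s => x s i j) (F (x t) (x (t - d)) i j)}].

Variables (F : V -> V -> V) (c : V).
Local Notation kappa := ((n * m)%:R : R).

Section LocalConstants.
Variables (R1 R2 B K L eta d : R).
Hypotheses (K0 : 0 <= K) (L0 : 0 <= L) (R1B : R1 < B) (d0 : 0 < d).
Hypothesis FK : forall X Y, `|X - c| <= B -> `|Y - c| <= B -> `|F X Y| <= K.
Hypothesis FL : forall X X' Y, `|X - c| <= B -> `|X' - c| <= B -> `|Y - c| <= B ->
  `|F X Y - F X' Y| <= L * `|X - X'|.
Hypothesis dissip : forall Y, R2 <= enorm (Y - c) -> mdot (Y - c) (F Y Y) <= - eta.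
Hypothesis R1R2 : R2 + 1 <= R1.
Hypothesis R1_ge1 : 1 <= R1.
Hypothesis small1 : kappa * K * d <= 1.
Hypothesis small2 : kappa * (K * K + B * L * K) * d <= eta.
Hypothesis small3 : L * d <= 1 / 2.

(** The delay perturbs the dissipation inequality by an amount proportional
    to the distance between the current and the delayed state. *)
Lemma delayed_dissipation X Y : enorm (X - c) <= B -> enorm (Y - c) <= B ->
  `|X - Y| <= K * d -> R1 <= enorm (X - c) -> mdot (X - c) (F X Y) <= 0.
Proof.
move=> XB YB XY XR1.
have XB' : `|X - c| <= B by exact: le_trans (mx_norm_le_enorm _) XB.
have YB' : `|Y - c| <= B by exact: le_trans (mx_norm_le_enorm _) YB.
have k0 : 0 <= kappa by [].
have B0 : 0 <= B by exact: le_trans XB'.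
have Kd0 : 0 <= K * d by rewrite mulr_ge0// ltW.
have Yfar : R2 <= enorm (Y - c).
  have := enormD (X - Y) (Y - c); rewrite addrA subrK => h.
  have : enorm (X - Y) <= 1.
    apply: le_trans (enorm_le_mx_norm _) _; apply: le_trans small1.
    by rewrite -mulrA ler_wpM2l.
  move: R1R2; lra.
have -> : mdot (X - c) (F X Y) = mdot (Y - c) (F Y Y) + mdot (X - Y) (F Y Y) +
    mdot (X - c) (F X Y - F Y Y).
  have E : X - c = (Y - c) + (X - Y) by rewrite [RHS]addrC addrA subrK.
  by rewrite -mdotDl -E mdotDr mdotNr; ring.
have h1 := dissip Yfar.
have h2 : mdot (X - Y) (F Y Y) <= kappa * (K * d * K).
  apply: le_trans (ler_norm _) _; apply: le_trans (normr_mdot_le _ _) _.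
  by apply: ler_wpM2l => //; apply: ler_pM => //; exact: FK.
have h3 : mdot (X - c) (F X Y - F Y Y) <= kappa * (B * (L * (K * d))).
  apply: le_trans (ler_norm _) _; apply: le_trans (normr_mdot_le _ _) _.
  apply: ler_wpM2l => //; apply: ler_pM => //.
  by apply: le_trans (FL XB' YB' YB') _; exact: ler_wpM2l.
move: small2; lra.
Qed.

(** A path with history in the ball of radius [R1 - 1] that obeys the delay
    equation whenever its current and delayed states are in the box of radius
    [B] never leaves the ball of radius [R1]. *)
Lemma a_priori_bound (x : R -> V) :
  (forall s, - d <= s <= 0 -> enorm (x s - c) <= R1 - 1) ->
  (forall T, 0 <= T -> abs_continuous 0 T x) ->
  {ae mu, forall t : R, 0 <= t -> `|x t - c| <= B -> `|x (t - d) - c| <= B ->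
    forall i j, is_derive t 1 (fun s => x s i j) (F (x t) (x (t - d)) i j)} ->
  forall t, - d <= t -> enorm (x t - c) <= R1.
Proof.
move=> xhist acx aex.
have B0 : 0 <= B by move: R1B R1_ge1; lra.
have k0 : 0 <= kappa by [].
suff fut : forall t, 0 <= t -> enorm (x t - c) <= R1.
  move=> t dt; have [/ltW t0|/fut//] := ltP t 0.
  by apply: le_trans (xhist t _) _; [rewrite dt|rewrite gerBl].
have x0 : enorm (x 0 - c) <= R1 - 1 by apply: xhist; rewrite lexx oppr_le0 ltW.
apply: (@bootstrap _ (fun t => enorm (x t - c)) R1 B) => //.
- by move=> T T0; apply: real_abs_continuous_enorm; exact: acx.
- by apply: le_trans x0 _; rewrite gerBl.
move=> T T0 xB.
have inB s : - d <= s -> s <= T -> enorm (x s - c) <= B.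
  move=> ds sT; have [s0|s0] := leP 0 s; first by apply: xB; rewrite s0.
  by apply: le_trans (xhist s _) _; [rewrite ds ltW|move: R1B; lra].
have inB' s : - d <= s -> s <= T -> `|x s - c| <= B.
  by move=> ds sT; apply: le_trans (mx_norm_le_enorm _) _; exact: inB.
have aeT : {ae mu, forall t : R, 0 <= t <= T -> forall i j,
    is_derive t 1 (fun s => x s i j) (F (x t) (x (t - d)) i j)}.
  apply: filterS aex => t xt /andP[t0 tT]; apply: xt => //; apply: inB' => //.
  - by apply: le_trans t0; rewrite oppr_le0 ltW.
  - by move: t0; lra.
  - by move: tT d0; lra.
have FxK t : 0 <= t -> t <= T -> `|F (x t) (x (t - d))| <= K.
  move=> t0 tT; apply: FK; apply: inB' => //.
  - by apply: le_trans t0; rewrite oppr_le0 ltW.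
  - by move: t0; lra.
  - by move: tT d0; lra.
have xlip s t : 0 <= s -> s <= t -> t <= T -> `|x t - x s| <= K * (t - s).
  move=> s0 st tT; apply: mx_norm_leP => [|i j]; first by rewrite mulr_ge0// subr_ge0.
  rewrite !mxE; apply: (@ae_derive_dist_le _ (fun t => x t i j) 0 T K) => //.
    by apply: real_abs_continuous_coord; exact: acx.
  apply: filterS aeT => u xu uT; eexists; last exact: xu.
  apply: le_trans (le_coord_mx_norm _ _ _) _.
  by move/andP : uT => [u0 uT]; exact: FxK.
have xlip' s t : 0 <= s -> s <= t -> t <= T -> t - s <= d -> enorm (x t - x s) <= 1.
  move=> s0 st tT tsd; apply: le_trans (enorm_le_mx_norm _) _.
  apply: le_trans small1; rewrite -mulrA ler_wpM2l//.
  by apply: le_trans (xlip s t s0 st tT) _; exact: ler_wpM2l.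
(* The history is only continuous, so up to time [d] the trajectory is compared
   with its value at [0]; later it is compared with its own past. *)
have early t : 0 <= t -> t <= T -> t <= d -> enorm (x t - c) <= R1.
  move=> t0 tT td; rewrite -(subrK (x 0) (x t)) -addrA.
  apply: le_trans (enormD _ _) _.
  by have := xlip' 0 t (lexx _) t0 tT; rewrite subr0 => /(_ td); move: x0; lra.
move=> t /andP[t0 tT]; have [td|/ltW dt] := leP t d; first exact: early.
apply: (@barrier _ d T (fun t => enorm (x t - c)) R1); last by rewrite dt.
- apply: (@real_abs_continuousW _ 0 T) => //; first exact: ltW.
  by apply: real_abs_continuous_enorm; exact: acx.
- by apply: early => //; [exact: ltW|exact: le_trans tT].
move=> s u ds su uT above.
have s0 : 0 <= s by apply: le_trans ds; exact: ltW.
rewrite -(@ler_pXn2r _ 2)// ?nnegrE ?enorm_ge0// !sqr_enorm -subr_le0.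
rewrite -[leRHS](mul0r (u - s)).
apply: (@ae_derive_le _ (fun t => mdot (x t - c) (x t - c))) => //.
  apply: (@real_abs_continuousW _ 0 T) => //.
  apply: (@real_abs_continuous_mdot _ _ _ _ _ _ _ B) => //; exact: acx.
apply: filterS aeT => r xr /andP[sr ru].
have r0 : 0 <= r by exact: le_trans sr.
have rT : r <= T by exact: le_trans uT.
exists (2 * mdot (x r - c) (F (x r) (x (r - d)))); last first.
  by apply: is_derive_mdot => i j; apply: xr; rewrite r0.
apply: mulr_ge0_le0 => //; apply: delayed_dissipation.
- by apply: inB => //; apply: le_trans r0; rewrite oppr_le0 ltW.
- by apply: inB; [move: r0; lra|move: rT d0; lra].
- apply: le_trans (xlip _ _ _ _ rT) _.
  + by rewrite subr_ge0 (le_trans ds).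
  + by rewrite gerBl ltW.
  + by rewrite opprB addrC subrK.
- by apply: above; rewrite sr.
Qed.

(** Two solutions in the box coincide: on each delay interval the difference
    contracts by one half. *)
Lemma delay_solution_unique (h x y : R -> V) :
  delay_solution F d h x -> delay_solution F d h y ->
  (forall t, - d <= t -> `|x t - c| <= B) ->
  (forall t, - d <= t -> `|y t - c| <= B) ->
  forall t, - d <= t -> x t = y t.
Proof.
move=> [xh acx aex] [yh acy aey] xB yB.
have step k t : - d <= t -> t <= k%:R * d -> x t = y t.
  elim: k t => [|k IHk] t dt tk.
    by rewrite mul0r in tk; rewrite xh ?yh ?dt.
  have [tk'|/ltW kt] := leP t (k%:R * d); first exact: IHk.
  have kd0 : 0 <= k%:R * d by rewrite mulr_ge0// ltW.
  have SE : k.+1%:R * d = k%:R * d + d by rewrite -natr1 mulrDl mul1r.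
  have pos s : k%:R * d <= s -> 0 <= s by exact: le_trans.
  have post s : k%:R * d <= s -> - d <= s.
    by move=> /pos; apply: le_trans; rewrite oppr_le0 ltW.
  have contract M : 0 <= M ->
      (forall s, k%:R * d <= s <= k.+1%:R * d -> `|x s - y s| <= M) ->
      forall s, k%:R * d <= s <= k.+1%:R * d -> `|x s - y s| <= M / 2.
    move=> M0 xyM s /andP[ks sk]; apply: mx_norm_leP => [|i j]; first by rewrite divr_ge0.
    have LM0 : 0 <= L * M by rewrite mulr_ge0.
    have := @ae_derive_dist_le _ (fun t => x t i j - y t i j) (k%:R * d) (k.+1%:R * d)
      (L * M) LM0 _ _ (k%:R * d) s (lexx _) ks sk.
    rewrite (IHk (k%:R * d)) ?post// subrr subr0 !mxE => H; apply: le_trans (H _ _) _.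
    - apply: (@real_abs_continuousW _ 0 (k.+1%:R * d)) => //.
      have k1 : 0 <= k.+1%:R * d by rewrite mulr_ge0// ltW.
      by apply: real_abs_continuousB; apply: real_abs_continuous_coord; [exact: acx|exact: acy].
    - apply: filterS2 aex aey => u xu yu /andP[ku uk].
      eexists; last by apply: is_deriveB; [exact: xu (pos _ ku) _ _|exact: yu (pos _ ku) _ _].
      have -> : x (u - d) = y (u - d).
        by apply: IHk; [have := pos _ ku; lra|move: uk; rewrite SE; lra].
      have := le_coord_mx_norm (F (x u) (y (u - d)) - F (y u) (y (u - d))) i j.
      rewrite !mxE => /le_trans; apply.
      apply: le_trans (FL _ _ _) _; [exact/xB/post|exact/yB/post| |].
        by apply: yB; have := pos _ ku; lra.
      by apply: ler_wpM2l => //; apply: xyM; rewrite ku.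
    have skd : s - k%:R * d <= d by move: sk; rewrite SE; lra.
    apply: le_trans (ler_wpM2l LM0 skd) _.
    by rewrite mulrAC [leRHS]mulrC -div1r; exact: ler_wpM2r.
  have B0 : 0 <= B *+ 2.
    by rewrite mulrn_wge0//; move: R1B R1_ge1; lra.
  have geo p : forall s, k%:R * d <= s <= k.+1%:R * d -> `|x s - y s| <= B *+ 2 / 2 ^+ p.
    elim: p => [|p IHp].
      move=> s /andP[ks _]; rewrite divr1 -(subrK c (x s)) -addrA.
      apply: le_trans (ler_normD _ _) _; rewrite mulr2n; apply: lerD; first exact/xB/post.
      by rewrite distrC; exact/yB/post.
    move=> s ks; rewrite exprSr invfM mulrA; apply: contract => //.
    by rewrite divr_ge0 ?exprn_ge0.
  apply/eqP; rewrite -subr_eq0 -normr_le0; apply: (@geometric_le0 _ (B *+ 2)) => p.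
  by apply: geo; rewrite kt.
move=> t dt; apply: (step (Num.truncn (t / d)).+1) => //.
by rewrite -ler_pdivrMr//; apply: ltW; exact: truncnS_gt.
Qed.

Hypothesis F_measurable : forall X Y : R -> V, continuous X -> continuous Y ->
  forall i j, measurable_fun [set: R] (fun t => F (X t) (Y t) i j).

(** Existence: the system clipped to the box of radius [B] has a global
    solution, which by the a priori bound stays where clipping is void. *)
Lemma delay_solution_exists (h : R -> V) :
  {within `[- d, 0], continuous h} ->
  (forall s, - d <= s <= 0 -> enorm (h s - c) <= R1 - 1) ->
  exists x, delay_solution F d h x.
Proof.
move=> ch hR1.
have B0 : 0 <= B by move: R1B R1_ge1; lra.
pose Fc X Y := F (clip c B X) (clip c B Y).
have FcK X Y : `|Fc X Y| <= K by apply: FK; exact: clip_box.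
have FcL X X' Y : `|Fc X Y - Fc X' Y| <= L * `|X - X'|.
  apply: le_trans (FL _ _ _) _; [exact: clip_box|exact: clip_box|exact: clip_box|].
  by apply: ler_wpM2l => //; exact: clip_dist.
have FcM X Y : continuous X -> continuous Y ->
    forall i j, measurable_fun [set: R] (fun t => Fc (X t) (Y t) i j).
  by move=> cX cY; apply: F_measurable; exact: clip_continuous.
have d0' : - d <= 0 by rewrite oppr_le0 ltW.
pose H (t : R) := h (Num.max (- d) (Num.min t 0)).
have cH : continuous H by exact: within_segment_clamp.
have HE s : - d <= s <= 0 -> H s = h s.
  by move=> /andP[ds s0]; rewrite /H (min_l s0) (max_r ds).
have [x [cx xpast xE]] := delay_integral_solution K0 L0 FcK FcL FcM cH d0 small3.
pose psi s := Fc (x s) (x (s - d)).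
have cxd : continuous (fun s => x (s - d)).
  move=> t; apply: (@continuous_comp _ _ _ (fun s => s - d) x); last exact: cx.
  by apply: cvgB; [exact: cvg_id|exact: cvg_cst].
have psi_bm : bounded_measurable_mx psi.
  move=> i j; split; first exact: FcM.
  by exists K => s; exact: le_trans (le_coord_mx_norm _ _ _) (FcK _ _).
have xhist s : - d <= s <= 0 -> x s = h s.
  by move=> /[dup] sd /andP[_ s0]; rewrite xpast// HE.
have acx T : 0 <= T -> abs_continuous 0 T x.
  move=> T0; apply: (@lipschitz_abs_continuous _ _ _ _ _ _ (kappa * K)).
    by rewrite mulr_ge0.
  move=> s t s0 st tT; apply: le_trans (enorm_le_mx_norm _) _.
  rewrite -mulrA; apply: ler_wpM2l => //.
  rewrite !xE ?(le_trans s0)// opprD addrACA subrr add0r.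
  by apply: primitive_mx_dist_le => // r _; exact: FcK.
have aec : {ae mu, forall t : R, 0 <= t -> forall i j,
    is_derive t 1 (fun s => x s i j) (Fc (x t) (x (t - d)) i j)}.
  have aeij (ij : 'I_n * 'I_m) : {ae mu, forall t : R, 0 <= t ->
      is_derive t 1 (primitive (fun s => psi s ij.1 ij.2)) (psi t ij.1 ij.2)}.
    exact: primitive_is_derive.
  have tn0 : {ae mu, forall t : R, t != 0}.
    exists [set 0]; split => //=; first exact: lebesgue_measure_set1.
    by move=> t /= /negP; rewrite negbK => /eqP.
  have aeall := filter_forall (lebesgue_ae_filter R) aeij.
  apply: filterS2 tn0 aeall => t tn0 Ht t0 i j.
  have tgt0 : 0 < t by rewrite lt_def tn0.
  have dP := Ht (i, j) t0.
  have dE : is_derive t 1 (cst (H 0 i j) + primitive (fun s => psi s i j)) (psi t i j).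
    by rewrite -[psi t i j]add0r; apply: is_deriveD.
  apply: near_eq_is_derive dE; near=> s.
  have s0 : 0 <= s by apply: ltW; near: s; exact: lt_nbhsr.
  by rewrite xE// !mxE.
exists x; split => //.
have bnd := @a_priori_bound x _ acx.
have xR1 t : - d <= t -> enorm (x t - c) <= R1.
  apply: bnd; first by move=> s sd; rewrite xhist//; exact: hR1.
  apply: filterS aec => s xs s0 sB sdB i j; have := xs s0 i j.
  by rewrite /Fc !clip_id.
apply: filterS aec => s xs s0 i j; have := xs s0 i j.
have inB u : - d <= u -> `|x u - c| <= B.
  by move=> /xR1 xu; apply: le_trans (mx_norm_le_enorm _) _; exact: le_trans xu (ltW R1B).
by rewrite /Fc !clip_id//; apply: inB; [rewrite lerBrDr addrC subrr|rewrite (le_trans d0')].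
Unshelve. all: by end_near. Qed.

End LocalConstants.

Let linear_small (A b : R) : 0 <= A -> 0 < b -> exists2 e, 0 < e &
  forall d, 0 < d -> d <= e -> A * d <= b.
Proof.
move=> A0 b0; have A1 : 0 < A + 1 by rewrite ltr_wpDl.
exists (b / (A + 1)); first exact: divr_gt0.
move=> d d0; rewrite ler_pdivlMr//; apply: le_trans.
by rewrite mulrC ler_pM2l// lerDl.
Qed.

(** A delay system that is bounded and Lipschitz in its undelayed argument on
    boxes, and dissipative without delay outside some ball, is for small
    delays well posed and bounded uniformly over bounded histories. *)
Theorem dissipative_delay_system (R0 R2 eta : R) :
  (forall B, 0 <= B -> exists K L, [/\ 0 <= K, 0 <= L,
    forall X Y, `|X - c| <= B -> `|Y - c| <= B -> `|F X Y| <= K &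
    forall X X' Y, `|X - c| <= B -> `|X' - c| <= B -> `|Y - c| <= B ->
      `|F X Y - F X' Y| <= L * `|X - X'|]) ->
  (forall X Y : R -> V, continuous X -> continuous Y ->
    forall i j, measurable_fun [set: R] (fun t => F (X t) (Y t) i j)) ->
  0 < eta ->
  (forall Y, R2 <= enorm (Y - c) -> mdot (Y - c) (F Y Y) <= - eta) ->
  exists2 dbar, 0 < dbar & exists2 R1, 0 <= R1 & forall d, 0 < d <= dbar ->
    forall h : R -> V, {within `[- d, 0], continuous h} ->
      (forall s, - d <= s <= 0 -> enorm (h s - c) <= R0) ->
      [/\ exists x, delay_solution F d h x,
          forall x y, delay_solution F d h x -> delay_solution F d h y ->
            forall t, - d <= t -> x t = y t &
          forall x, delay_solution F d h x ->
            forall t, - d <= t -> enorm (x t - c) <= R1].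
Proof.
move=> Hloc Hmeas eta0 dissip.
(* [R1] exceeds by [1] both the size of the histories and the radius beyond
   which the undelayed field is dissipative; trajectories move by at most [1]
   during one delay. *)
pose R1 := `|R0| + `|R2| + 1.
have hR0 := ler_norm R0; have hR2 := ler_norm R2.
have hR0' := normr_ge0 R0; have hR2' := normr_ge0 R2.
have R11 : 1 <= R1 by rewrite /R1; lra.
have B0 : 0 <= R1 + 1 by move: R11; lra.
have [K [L [K0 L0 FK FL]]] := Hloc _ B0.
have R1B : R1 < R1 + 1 by rewrite ltrDl.
have R12 : R2 + 1 <= R1 by rewrite /R1; lra.
have R10 : R0 <= R1 - 1 by rewrite /R1; lra.
have kap0 : 0 <= kappa by [].
have [e1 e10 H1] := linear_small (mulr_ge0 kap0 K0) ltr01.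
have A2 : 0 <= kappa * (K * K + (R1 + 1) * L * K).
  by rewrite mulr_ge0// addr_ge0// !mulr_ge0.
have [e2 e20 H2] := linear_small A2 eta0.
have half0 : 0 < 1 / 2 :> R by rewrite divr_gt0.
have [e3 e30 H3] := linear_small L0 half0.
exists (Num.min e1 (Num.min e2 e3)); first by rewrite !lt_min e10 e20.
exists R1; first by move: R11; lra.
move=> d /andP[d0]; rewrite !le_min => /and3P[de1 de2 de3] h ch hR.
have {}H1 := H1 d d0 de1; have {}H2 := H2 d d0 de2; have {}H3 := H3 d d0 de3.
have hR' s : - d <= s <= 0 -> enorm (h s - c) <= R1 - 1.
  by move=> /hR /le_trans; apply.
have bnd x : delay_solution F d h x -> forall t, - d <= t -> enorm (x t - c) <= R1.
  move=> [xh acx aex].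
  apply: (a_priori_bound K0 L0 R1B d0 FK FL dissip R12 R11 H1 H2) => //.
    by move=> s sd; rewrite xh//; exact: hR'.
  by apply: filterS aex => t xt t0 _ _; exact: xt.
have bnd' x : delay_solution F d h x -> forall t, - d <= t -> `|x t - c| <= R1 + 1.
  move=> xs t dt; apply: le_trans (mx_norm_le_enorm _) _.
  exact: le_trans (bnd x xs t dt) (ltW R1B).
split => //.
- exact: (delay_solution_exists K0 L0 R1B d0 FK FL dissip R12 R11 H1 H2 H3).
- move=> x y xs ys.
  by apply: (delay_solution_unique L0 R1B d0 FL R11 H3 xs ys); exact: bnd'.
Qed.

End DelaySystem.

(** * The SIDT closed loop *)

Section GraphDissipation.
Context {R : realType} {n : nat}.

(** A symmetric nonnegative coupling through an odd function that has the sign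
    of its argument is dissipative. *)
Lemma coupling_dissipative (w : 'I_n -> 'I_n -> R) (k : R -> R) (z : 'I_n -> R) :
  (forall i j, w i j = w j i) -> (forall i j, 0 <= w i j) ->
  (forall s, k (- s) = - k s) -> (forall s, 0 <= s * k s) ->
  \sum_i z i * (\sum_j w i j * k (z j - z i)) <= 0.
Proof.
move=> wC w0 kN k0; set T := (X in X <= 0).
have TE : T = \sum_i \sum_j w i j * (z i * k (z j - z i)).
  by apply: eq_bigr => i _; rewrite mulr_sumr; apply: eq_bigr => j _; rewrite mulrCA.
have TE' : T = - \sum_i \sum_j w i j * (z j * k (z j - z i)).
  rewrite TE exchange_big/= -sumrN; apply: eq_bigr => i _.
  rewrite -sumrN; apply: eq_bigr => j _.
  by rewrite wC -[z i - z j]opprB kN !mulrN.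
have : T + T <= 0.
  rewrite {1}TE TE' -sumrB -oppr_ge0 -sumrN; apply: sumr_ge0 => i _.
  rewrite -sumrB -sumrN; apply: sumr_ge0 => j _.
  by rewrite -mulrBr -mulrBl -mulrN -mulNr opprB mulr_ge0.
by rewrite -mulr2n pmulrn_lle0.
Qed.

End GraphDissipation.

Section BoundedOn.
Context {R : realType} {T : Type}.

(** Boundedness of [u] on the subset [A] of its domain. *)
Definition bounded_on (W : normedModType R) (A : T -> Prop) (u : T -> W) : Prop :=
  exists M, forall x, A x -> `|u x| <= M.

Lemma bounded_on_cst (W : normedModType R) (A : T -> Prop) (a : W) :
  bounded_on A (fun=> a).
Proof. by exists `|a|. Qed.

Lemma bounded_onD (W : normedModType R) (A : T -> Prop) (u v : T -> W) :
  bounded_on A u -> bounded_on A v -> bounded_on A (fun x => u x + v x).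
Proof.
move=> [M uM] [N vN]; exists (M + N) => x Ax.
by apply: le_trans (ler_normD _ _) _; apply: lerD; [exact: uM|exact: vN].
Qed.

Lemma bounded_onN (W : normedModType R) (A : T -> Prop) (u : T -> W) :
  bounded_on A u -> bounded_on A (fun x => - u x).
Proof. by move=> [M uM]; exists M => x Ax; rewrite normrN uM. Qed.

Lemma bounded_onZ (W : normedModType R) (A : T -> Prop) (s : T -> R) (u : T -> W) :
  bounded_on (A : T -> Prop) (s : T -> R^o) -> bounded_on A u ->
  bounded_on A (fun x => s x *: u x).
Proof.
move=> [M sM] [N uN]; exists (M * N) => x Ax.
by rewrite normrZ; apply: ler_pM => //; [exact: sM|exact: uN].
Qed.

Lemma bounded_on_sum (W : normedModType R) (A : T -> Prop) (I : Type) (r : seq I)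
    (P : pred I) (u : I -> T -> W) :
  (forall i, P i -> bounded_on A (u i)) ->
  bounded_on A (fun x => \sum_(i <- r | P i) u i x).
Proof.
move=> ub; elim: r => [|i r [M IH]].
  by exists 0 => x _; rewrite big_nil normr0.
have [Pi|nPi] := boolP (P i); last by exists M => x Ax; rewrite big_cons (negbTE nPi) IH.
have [N uN] := ub i Pi; exists (N + M) => x Ax; rewrite big_cons Pi.
by apply: le_trans (ler_normD _ _) _; apply: lerD; [exact: uN|exact: IH].
Qed.

End BoundedOn.

Section ClosedLoop.
Context {R : realType} {n m : nat}.
Local Notation V := 'M[R]_(n, m).
Variables (E : rel 'I_n) (a : 'I_n -> 'I_n -> R).
Variables (f : 'I_n -> 'rV[R]_m -> 'rV[R]_m) (g : 'I_n -> 'rV[R]_m -> R).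
Variables (phi : 'I_n -> 'rV[R]_m -> R) (vartheta k0 eps : R).

Local Notation ub := (ubar E a phi vartheta k0 eps).
Local Notation u := (sidt_input E a f g phi vartheta k0 eps).

(** The right-hand side of the closed loop, as a function of the current
    stacked state [X] and of the delayed one [Y]. *)
Definition closed_loop_field (X Y : V) : V :=
  \matrix_(i, j) (f i (row i X) + g i (row i X) *: u i Y) 0 j.

Local Notation F := closed_loop_field.

Lemma mx_norm_row (X : V) i : `|row i X| <= `|X|.
Proof. by apply: mx_norm_leP => // k j; rewrite mxE; exact: le_coord_mx_norm. Qed.

Lemma enorm_row (X : V) i : enorm (row i X) <= enorm X.
Proof.
apply: ler_wsqrtr; rewrite big_ord1 (bigD1 i)//= (eq_bigr (fun j => X i j ^+ 2)).
  by rewrite lerDl; apply: sumr_ge0 => k _; apply: sumr_ge0 => j _; exact: sqr_ge0.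
by move=> j _; rewrite mxE.
Qed.

Lemma sqr_enorm_rows (X : V) : enorm X ^+ 2 = \sum_i enorm (row i X) ^+ 2.
Proof.
rewrite sqr_enorm; apply: eq_bigr => i _; rewrite sqr_enorm /mdot big_ord1.
by apply: eq_bigr => j _; rewrite mxE.
Qed.

Hypothesis A1 : forall i, Ck 1 (g i) /\
  exists gmin gmax : R, [/\ 0 < gmin, gmin <= gmax &
    forall x, gmin <= `|g i x| <= gmax].

Lemma g_neq0 i x : g i x != 0.
Proof.
have [_ [gmin [gmax [gmin0 _ /(_ x)/andP[gx _]]]]] := A1 i.
by rewrite -normr_gt0 (lt_le_trans gmin0).
Qed.

Lemma row_closed_loop_field (X Y : V) i :
  row i (F X Y) = f i (row i X) + g i (row i X) *: u i Y.
Proof. by apply/rowP => j; rewrite 2!mxE. Qed.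

(** Without delay the nonlinearities [f] and [g] cancel. *)
Lemma closed_loop_field_diag (Y : V) i : row i (F Y Y) = ub i Y.
Proof.
by rewrite row_closed_loop_field /sidt_input scalerA divff ?g_neq0// scale1r addrC subrK.
Qed.

Hypothesis A2 : forall i, Ck 2 (phi i) /\ exists L : R, forall y z,
  enorm (grad (phi i) y - grad (phi i) z) <= L * enorm (y - z).

Lemma grad_lipschitz i : exists2 L, 0 <= L & forall y z,
  enorm (grad (phi i) y - grad (phi i) z) <= L * `|y - z|.
Proof.
have [_ [L LP]] := A2 i; exists (`|L| * (1 * m)%:R); first by rewrite mulr_ge0.
move=> y z; apply: le_trans (LP y z) _.
apply: le_trans (ler_wpM2r (enorm_ge0 _) (ler_norm L)) _.
by rewrite -mulrA; apply: ler_wpM2l => //; exact: enorm_le_mx_norm.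
Qed.

Section LocalBounds.
Variables (c : V) (B : R).

Local Notation inbox := (fun Y : V => is_true (`|Y - c| <= B)).

Lemma inbox_row i (Y : V) : `|Y - c| <= B -> `|row i Y - row i c| <= B.
Proof. by move=> YB; rewrite -linearB; apply: le_trans (mx_norm_row _ _) YB. Qed.

Lemma row_bounded_on i : bounded_on inbox (fun Y : V => row i Y).
Proof.
exists (B + `|row i c|) => Y YB; rewrite -(subrK (row i c) (row i Y)).
by apply: le_trans (ler_normD _ _) _; rewrite lerD2r; exact: inbox_row.
Qed.

Lemma ubar_eta_bounded_on i : bounded_on inbox (fun Y : V => ubar_eta phi k0 i Y).
Proof.
have [L L0 LP] := grad_lipschitz i.
exists (`|k0| * (L * B + `|grad (phi i) (row i c)|)) => Y YB.
rewrite /ubar_eta normrN normrZ; apply: ler_wpM2l => //.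
rewrite -(subrK (grad (phi i) (row i c)) (grad (phi i) (row i Y))).
apply: le_trans (ler_normD _ _) _; rewrite lerD2r.
apply: le_trans (mx_norm_le_enorm _) _; apply: le_trans (LP _ _) _.
by apply: ler_wpM2l => //; exact: inbox_row.
Qed.

Lemma wp_bounded_on i j :
  bounded_on inbox (fun Y : V => wp phi k0 i j Y : R^o).
Proof.
have enb k : bounded_on inbox (fun Y : V => enorm (ubar_eta phi k0 k Y) : R^o).
  have [M MP] := ubar_eta_bounded_on k; exists ((1 * m)%:R * M) => Y YB.
  rewrite ger0_norm ?enorm_ge0//; apply: le_trans (enorm_le_mx_norm _) _.
  by apply: ler_wpM2l => //; exact: MP.
exact: bounded_onD (enb i) (enb j).
Qed.

Lemma ubar_bounded_on i : bounded_on inbox (fun Y : V => ub i Y).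
Proof.
apply: bounded_onD; [apply: bounded_onD|exact: ubar_eta_bounded_on].
- apply: bounded_onZ; first exact: (@bounded_on_cst _ _ R^o).
  apply: bounded_on_sum => j _; apply: bounded_onZ; first exact: (@bounded_on_cst _ _ R^o).
  by apply: bounded_onD; [|apply: bounded_onN]; exact: row_bounded_on.
- apply: bounded_onZ; first exact: (@bounded_on_cst _ _ R^o).
  apply: bounded_on_sum => j _; apply: bounded_onZ; first exact: wp_bounded_on.
  exists 1 => Y _; apply: mx_norm_leP => // k l; rewrite mxE normr_sg.
  by case: (_ != _).
Qed.

Hypothesis f_smooth : forall i, smooth (f i).
Hypothesis B0 : 0 <= B.

Lemma f_row_bounded_on i : bounded_on inbox (fun Y : V => f i (row i Y)).
Proof.
have [L L0 LP] := C1_box_lipschitz_vec (row i c) B (f_smooth i 1%N).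
exists (L * B + `|f i (row i c)|) => Y YB.
rewrite -(subrK (f i (row i c)) (f i (row i Y))).
apply: le_trans (ler_normD _ _) _; rewrite lerD2r.
apply: le_trans (LP _ _ (inbox_row i YB) _) _; first by rewrite subrr normr0.
by apply: ler_wpM2l => //; exact: inbox_row.
Qed.

Lemma sidt_input_bounded_on i : bounded_on inbox (fun Y : V => u i Y).
Proof.
apply: bounded_onZ.
  have [_ [gmin [gmax [gmin0 _ gP]]]] := A1 i; exists gmin^-1 => Y _.
  have /andP[gY _] := gP (row i Y).
  by rewrite normfV lef_pV2 ?posrE// (lt_le_trans gmin0).
by apply: bounded_onD; [exact: ubar_bounded_on|apply: bounded_onN; exact: f_row_bounded_on].
Qed.

Lemma closed_loop_field_row_local i : exists K L, [/\ 0 <= K, 0 <= L,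
  forall X Y, `|X - c| <= B -> `|Y - c| <= B -> `|row i (F X Y)| <= K &
  forall X X' Y, `|X - c| <= B -> `|X' - c| <= B -> `|Y - c| <= B ->
    `|row i (F X Y) - row i (F X' Y)| <= L * `|X - X'|].
Proof.
have [_ [gmin [gmax [_ _ gP]]]] := A1 i.
have [Mf MfP] := f_row_bounded_on i; have [Mu MuP] := sidt_input_bounded_on i.
have [Lf Lf0 LfP] := C1_box_lipschitz_vec (row i c) B (f_smooth i 1%N).
have [Lg Lg0 LgP] := C1_box_lipschitz (row i c) B (A1 i).1.
have cB : `|c - c| <= B by rewrite subrr normr0.
have Mf0 : 0 <= Mf by exact: le_trans (MfP c cB).
have Mu0 : 0 <= Mu by exact: le_trans (MuP c cB).
have gmax0 : 0 <= gmax by have /andP[_] := gP 0; exact: le_trans.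
exists (Mf + gmax * Mu), (Lf + Lg * Mu); split.
- by rewrite addr_ge0// mulr_ge0.
- by rewrite addr_ge0// mulr_ge0.
- move=> X Y XB YB; rewrite row_closed_loop_field.
  apply: le_trans (ler_normD _ _) _; apply: lerD; first exact: MfP.
  rewrite normrZ; apply: ler_pM => //; last exact: MuP.
  by have /andP[] := gP (row i X).
- move=> X X' Y XB XB' YB; rewrite !row_closed_loop_field.
  rewrite opprD addrACA -scalerBl mulrDl.
  have rowXX : `|row i X - row i X'| <= `|X - X'|.
    by rewrite -linearB; exact: mx_norm_row.
  apply: le_trans (ler_normD _ _) _; apply: lerD.
    apply: le_trans (LfP _ _ (inbox_row i XB) (inbox_row i XB')) _.
    exact: ler_wpM2l.
  rewrite normrZ mulrAC; apply: ler_pM => //; last exact: MuP.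
  apply: le_trans (LgP _ _ (inbox_row i XB) (inbox_row i XB')) _.
  exact: ler_wpM2l.
Qed.

(** The field is bounded on boxes and Lipschitz there in the current state;
    nothing of the kind holds in the delayed state, through which the signs
    enter. *)
Lemma closed_loop_field_local : exists K L, [/\ 0 <= K, 0 <= L,
  forall X Y, `|X - c| <= B -> `|Y - c| <= B -> `|F X Y| <= K &
  forall X X' Y, `|X - c| <= B -> `|X' - c| <= B -> `|Y - c| <= B ->
    `|F X Y - F X' Y| <= L * `|X - X'|].
Proof.
have /choice[K /choice[L KL]] := closed_loop_field_row_local.
have K0 i : 0 <= K i by have [] := KL i.
have L0 i : 0 <= L i by have [] := KL i.
exists (\sum_i K i), (\sum_i L i); split.
- exact: sumr_ge0.
- exact: sumr_ge0.
- move=> X Y XB YB; apply: mx_norm_leP => [|i j]; first exact: sumr_ge0.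
  have [_ _ /(_ X Y XB YB) KP _] := KL i.
  have := le_trans (le_coord_mx_norm (row i (F X Y)) 0 j) KP.
  rewrite mxE => /le_trans; apply.
  by rewrite (bigD1 i)//= lerDl; exact: sumr_ge0.
- move=> X X' Y XB XB' YB; apply: mx_norm_leP => [|i j].
    by rewrite mulr_ge0// sumr_ge0.
  have [_ _ _ /(_ X X' Y XB XB' YB) LP] := KL i.
  have := le_trans (le_coord_mx_norm (row i (F X Y) - row i (F X' Y)) 0 j) LP.
  rewrite -linearB mxE => /le_trans; apply; apply: ler_wpM2r => //.
  by rewrite (bigD1 i)//= lerDl; exact: sumr_ge0.
Qed.

End LocalBounds.
End ClosedLoop.

Section LipschitzComposition.
Context {R : realType} {W W' : normedModType R}.

Lemma lipschitz_comp_continuous (r : W -> W') (L : R) (x : R -> W) : 0 <= L ->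
  (forall y z, `|r y - r z| <= L * `|y - z|) -> continuous x ->
  continuous (fun t => r (x t)).
Proof.
move=> L0 rL cx t; apply/cvgrPdist_le => /= e e0.
have L1 : 0 < L + 1 by rewrite ltr_wpDl.
have eL : 0 < e / (L + 1) by rewrite divr_gt0.
have /cvgrPdist_le/(_ _ eL) := cx t; apply: filterS => s ts.
apply: le_trans (rL _ _) _; rewrite ler_pdivlMr// mulrC in ts.
by apply: le_trans ts; rewrite ler_wpM2r// lerDl.
Qed.

End LipschitzComposition.

Lemma measurable_fun_sg (R : realType) (h : R -> R) :
  measurable_fun [set: R] h -> measurable_fun [set: R] (fun t => Num.sg (h t)).
Proof.
move=> mh; rewrite (_ : (fun t => _) = fun t => if 0 < h t then 1 else if h t < 0 then -1 else 0).
  apply: measurable_fun_ifT; [exact: measurable_fun_ltr|exact: measurable_cst|].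
  by apply: measurable_fun_ifT; [exact: measurable_fun_ltr|exact: measurable_cst..].
apply/funext => t; case: (ltrgtP 0 (h t)) => [h0|h0|<-].
- by rewrite gtr0_sg.
- by rewrite ltr0_sg.
- by rewrite sgr0.
Qed.

Section ClosedLoopProperties.
Context {R : realType} {n m : nat}.
Local Notation V := 'M[R]_(n, m).
Variables (E : rel 'I_n) (a : 'I_n -> 'I_n -> R).
Variables (f : 'I_n -> 'rV[R]_m -> 'rV[R]_m) (g : 'I_n -> 'rV[R]_m -> R).
Variables (phi : 'I_n -> 'rV[R]_m -> R) (vartheta k0 eps : R).
Hypothesis A1 : forall i, Ck 1 (g i) /\
  exists gmin gmax : R, [/\ 0 < gmin, gmin <= gmax &
    forall x, gmin <= `|g i x| <= gmax].
Hypothesis A2 : forall i, Ck 2 (phi i) /\ exists L : R, forall y z,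
  enorm (grad (phi i) y - grad (phi i) z) <= L * enorm (y - z).
Hypothesis f_smooth : forall i, smooth (f i).

Local Notation ub := (ubar E a phi vartheta k0 eps).
Local Notation u := (sidt_input E a f g phi vartheta k0 eps).
Local Notation F := (closed_loop_field E a f g phi vartheta k0 eps).

Lemma ubarE i (X : V) j : ub i X 0 j =
  vartheta * (\sum_k a i k * (X k j - X i j)) +
  eps * (\sum_k (if E i k then wp phi k0 i k X * Num.sg (X k j - X i j) else 0)) +
  ubar_eta phi k0 i X 0 j.
Proof.
rewrite /ubar -big_mkcond/= [LHS]mxE [X in X + _ = _]mxE; congr (_ + _ + _).
  by rewrite mxE summxE; congr (_ * _); apply: eq_bigr => k _; rewrite !mxE.
rewrite mxE summxE; congr (_ * _); apply: eq_bigr => k _.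
by rewrite [LHS]mxE /sign_vec mxE !mxE.
Qed.

Section Measurability.
Variable Y : R -> V.
Hypothesis cY : continuous Y.

Let row_continuous i : continuous (fun t => row i (Y t)).
Proof.
apply: (lipschitz_comp_continuous ler01) cY => X Z.
by rewrite mul1r -linearB; exact: mx_norm_row.
Qed.

Let entry_measurable i j : measurable_fun [set: R] (fun t => Y t i j).
Proof.
apply: continuous_measurable_fun => t.
apply: (@continuous_comp _ _ _ Y (fun M : V => M i j)); first exact: cY.
exact: coord_continuous.
Qed.

Let f_measurable i j : measurable_fun [set: R] (fun t => f i (row i (Y t)) 0 j).
Proof.
apply: continuous_measurable_fun => t.
apply: (@continuous_comp _ _ _ (fun t => row i (Y t)) (fun x => f i x 0 j)).
  exact: row_continuous.
exact: (Ck1_coord j (f_smooth i 1%N)).1.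
Qed.

Let g_continuous i : continuous (fun t => g i (row i (Y t))).
Proof.
move=> t; apply: (@continuous_comp _ _ _ (fun t => row i (Y t)) (g i)).
  exact: row_continuous.
exact: (A1 i).1.1.
Qed.

Let ubar_eta_measurable i j :
  measurable_fun [set: R] (fun t => ubar_eta phi k0 i (Y t) 0 j).
Proof.
have [L L0 LP] := grad_lipschitz A2 i.
have kL0 : 0 <= `|k0| * L by rewrite mulr_ge0.
apply: continuous_measurable_fun.
apply: (@lipschitz_comp_continuous R 'rV[R]_m R^o (fun y => (- (k0 *: grad (phi i) y)) 0 j)
  _ _ kL0 _ (@row_continuous i)).
move=> y z; rewrite [X in `|X|](_ : _ = - (k0 * (grad (phi i) y - grad (phi i) z) 0 j)).
  rewrite normrN normrM -mulrA; apply: ler_wpM2l => //.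
  by apply: le_trans (LP y z); exact: coord_le_enorm.
by rewrite !mxE; ring.
Qed.

Let enorm_ubar_eta_measurable i :
  measurable_fun [set: R] (fun t => enorm (ubar_eta phi k0 i (Y t))).
Proof.
have [L L0 LP] := grad_lipschitz A2 i.
have kL0 : 0 <= (1 * m)%:R * (`|k0| * L) by rewrite !mulr_ge0.
apply: continuous_measurable_fun.
apply: (@lipschitz_comp_continuous R 'rV[R]_m R^o (fun y => enorm (- (k0 *: grad (phi i) y)))
  _ _ kL0 _ (@row_continuous i)).
move=> y z; apply: le_trans (enormB_dist _ _) _.
apply: le_trans (enorm_le_mx_norm _) _; rewrite -mulrA; apply: ler_wpM2l => //.
rewrite -opprD normrN -scalerBr normrZ -mulrA; apply: ler_wpM2l => //.
by apply: le_trans (mx_norm_le_enorm _) _; exact: LP.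
Qed.

Lemma ubar_measurable i j : measurable_fun [set: R] (fun t => ub i (Y t) 0 j).
Proof.
have diffM k : measurable_fun [set: R] (fun t => Y t k j - Y t i j).
  by apply: measurable_funB; exact: entry_measurable.
under eq_fun do rewrite ubarE.
apply: measurable_funD; [apply: measurable_funD|exact: ubar_eta_measurable].
- apply: measurable_funM; first exact: measurable_cst.
  apply: measurable_sum => k; apply: measurable_funM; [exact: measurable_cst|exact: diffM].
- apply: measurable_funM; first exact: measurable_cst.
  apply: measurable_sum => k; case: (E i k) => /=; last exact: measurable_cst.
  apply: measurable_funM; last exact: measurable_fun_sg (diffM k).
  by apply: measurable_funD; exact: enorm_ubar_eta_measurable.
Qed.

Lemma sidt_input_measurable i j : measurable_fun [set: R] (fun t => u i (Y t) 0 j).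
Proof.
rewrite (_ : (fun t => _) = fun t => (g i (row i (Y t)))^-1 *
    (ub i (Y t) 0 j - f i (row i (Y t)) 0 j)); last first.
  by apply/funext => t; rewrite /sidt_input mxE [X in _ * X]mxE [X in _ + X]mxE.
apply: measurable_funM; last first.
  by apply: measurable_funB; [exact: ubar_measurable|exact: f_measurable].
apply: continuous_measurable_fun => t; apply: cvgV; last exact: g_continuous.
exact: g_neq0.
Qed.

Lemma f_row_measurable i j : measurable_fun [set: R] (fun t => f i (row i (Y t)) 0 j).
Proof. exact: f_measurable. Qed.

Lemma g_row_measurable i : measurable_fun [set: R] (fun t => g i (row i (Y t))).
Proof. by apply: continuous_measurable_fun; exact: g_continuous. Qed.

End Measurability.

Lemma closed_loop_field_measurable (X Y : R -> V) : continuous X -> continuous Y ->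
  forall i j, measurable_fun [set: R] (fun t => F (X t) (Y t) i j).
Proof.
move=> cX cY i j.
rewrite (_ : (fun t => _) = fun t => f i (row i (X t)) 0 j +
    g i (row i (X t)) * u i (Y t) 0 j); last first.
  by apply/funext => t; rewrite mxE mxE [X in _ + X]mxE.
apply: measurable_funD; first exact: f_row_measurable.
by apply: measurable_funM; [exact: g_row_measurable|exact: sidt_input_measurable].
Qed.

Hypothesis A3 : forall i, exists2 mu : R, 0 < mu & strongly_convex mu (phi i).
Hypothesis E_sym : symmetric E.
Hypothesis a_sym : forall i j, a i j = a j i.
Hypothesis a_ge0 : forall i j, 0 <= a i j.
Hypothesis vartheta_ge0 : 0 <= vartheta.
Hypothesis eps_ge0 : 0 <= eps.
Hypothesis k0_gt0 : 0 < k0.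

(** Without delay both coupling terms are dissipative, so that the gradient
    term alone pulls the state towards any consensus point. *)
Lemma closed_loop_field_dissipative (c Y : V) : consensus c ->
  mdot (Y - c) (F Y Y) <=
    - k0 * \sum_i mdot (row i Y - row i c) (grad (phi i) (row i Y)).
Proof.
move=> cc; have cE i k j : c i j = c k j.
  by have /rowP/(_ j) := cc i k; rewrite !mxE.
pose z j i := (Y - c) i j.
have zE j i k : Y k j - Y i j = z j k - z j i.
  by rewrite /z !mxE (cE i k); ring.
pose S1 := \sum_j \sum_i z j i * (\sum_k a i k * idfun (z j k - z j i)).
pose w i k := if E i k then wp phi k0 i k Y else 0.
pose S2 := \sum_j \sum_i z j i * (\sum_k w i k * Num.sg (z j k - z j i)).
have wpC i k : wp phi k0 i k Y = wp phi k0 k i Y by exact: addrC.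
have S1_le0 : S1 <= 0.
  apply: sumr_le0 => j _; apply: coupling_dissipative => // s.
  by rewrite -expr2 sqr_ge0.
have wp_ge0 i k : 0 <= wp phi k0 i k Y by rewrite addr_ge0 ?enorm_ge0.
have S2_le0 : S2 <= 0.
  apply: sumr_le0 => j _; apply: coupling_dissipative => [i k|i k|s|s].
  - by rewrite /w E_sym wpC.
  - by rewrite /w; case: ifP.
  - by rewrite sgrN.
  - by rewrite mulrC -normrEsg.
have -> : mdot (Y - c) (F Y Y) = vartheta * S1 + eps * S2 +
    - k0 * \sum_i mdot (row i Y - row i c) (grad (phi i) (row i Y)).
  rewrite /S1 /S2 [X in vartheta * X]exchange_big [X in eps * X]exchange_big/=.
  rewrite !mulr_sumr -!big_split; apply: eq_bigr => i _ /=.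
  rewrite /mdot big_ord1 !mulr_sumr -!big_split; apply: eq_bigr => j _ /=.
  have /rowP/(_ j) := closed_loop_field_diag E a f phi vartheta k0 eps A1 Y i.
  rewrite mxE => ->; rewrite ubarE.
  rewrite (eq_bigr (fun k => a i k * (z j k - z j i))); last by move=> k _; rewrite -zE.
  rewrite [X in eps * X](eq_bigr (fun k => w i k * Num.sg (z j k - z j i))); last first.
    by move=> k _; rewrite -zE /w; case: (E i k); rewrite ?mul0r.
  have -> : ubar_eta phi k0 i Y 0 j = - (k0 * grad (phi i) (row i Y) 0 j).
    by rewrite /ubar_eta mxE [X in - X]mxE.
  have -> : (row i Y - row i c) 0 j = z j i by rewrite /z !mxE.
  by rewrite -/(z j i); ring.
by rewrite gerDr -[leRHS]addr0; apply: lerD; exact: mulr_ge0_le0.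
Qed.

(** Outside a large ball the undelayed closed loop dissipates energy at a rate
    bounded away from zero. *)
Lemma closed_loop_field_coercive (c : V) : consensus c ->
  exists R2, forall Y, R2 <= enorm (Y - c) -> mdot (Y - c) (F Y Y) <= - k0.
Proof.
move=> cc; have /choice[mu muP] i : exists mu, 0 < mu /\ strongly_convex mu (phi i).
  by have [mu mu0 sc] := A3 i; exists mu.
have mui0 i : 0 < (mu i)^-1 by rewrite invr_gt0; exact: (muP i).1.
(* A common lower bound for the finitely many convexity moduli. *)
pose nu := (1 + \sum_i (mu i)^-1)^-1.
have den0 : 0 < 1 + \sum_i (mu i)^-1.
  by rewrite ltr_wpDr// sumr_ge0// => i _; exact: ltW.
have nu0 : 0 < nu by rewrite invr_gt0.
have nuP i : nu <= mu i.
  rewrite -[leRHS]invrK lef_pV2 ?posrE//.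
  rewrite (bigD1 i)//= addrCA lerDl addr_ge0// sumr_ge0// => k _; exact: ltW.
pose G := \sum_i enorm (grad (phi i) (row i c)).
have G0 : 0 <= G by apply: sumr_ge0 => i _; exact: enorm_ge0.
exists ((G + 1) / nu + 1) => Y far.
apply: le_trans (closed_loop_field_dissipative Y cc) _.
rewrite mulNr lerN2 -[leLHS]mulr1; apply: ler_wpM2l; first exact: ltW.
set e := enorm (Y - c).
have coer : nu * e ^+ 2 - G * e <=
    \sum_i mdot (row i Y - row i c) (grad (phi i) (row i Y)).
  rewrite /e sqr_enorm_rows mulr_sumr /G mulr_suml -sumrB; apply: ler_sum => i _.
  have := strongly_convex_coercive (row i Y) (row i c) (muP i).1 (Ck_S (A2 i).1) (muP i).2.
  apply: le_trans; rewrite -linearB; apply: lerB.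
    by apply: ler_wpM2r; [exact: sqr_ge0|exact: nuP].
  by apply: ler_wpM2l; [exact: enorm_ge0|exact: enorm_row].
apply: le_trans coer.
have h : G + 1 <= nu * e.
  by rewrite mulrC -ler_pdivrMr//; apply: le_trans far; rewrite lerDl.
have e1 : 1 <= e.
  by apply: le_trans far; rewrite lerDr divr_ge0 ?addr_ge0// ltW.
by nra.
Qed.

End ClosedLoopProperties.

(** * Practical convergence *)

Section Transfer.
Context {R : realType} {n m : nat}.
Local Notation V := 'M[R]_(n, m).

Lemma is_derive_rowP (x : R -> 'rV[R]_m) (t : R) (D : 'rV[R]_m) :
  is_derive t 1 x D <-> forall j, is_derive t 1 (fun s => x s 0 j) (D 0 j).
Proof.
split=> [xD j|xD].
  have dx : derivable x t 1 by exact: ex_derive.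
  have dxj : derivable (fun s => x s 0 j) t 1 by have /derivable_mxP := dx; exact.
  split=> //; have := @derive_val _ _ _ _ _ _ _ xD.
  by rewrite derive_mx// => <-; rewrite mxE.
have dx : derivable x t 1.
  by apply/derivable_mxP => i j; rewrite ord1; exact: ex_derive.
split=> //; rewrite derive_mx//; apply/rowP => j; rewrite mxE.
by have := xD j => xDj; rewrite derive_val.
Qed.

(** The stacked history with the given rows. *)
Definition stack_rows (h : 'I_n -> R -> 'rV[R]_m) (s : R) : V :=
  \matrix_(i, j) h i s 0 j.

Lemma row_stack_rows h s i : row i (stack_rows h s) = h i s.
Proof. by apply/rowP => j; rewrite !mxE. Qed.

Lemma stack_rows_within_continuous (A : set R) h :
  (forall i, {within A, continuous (h i)}) -> {within A, continuous (stack_rows h)}.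
Proof.
move=> ch t; apply/cvgrPdist_le => /= e e0.
have hnear i : \forall s \near nbhs (t : subspace A), `|h i t - h i s| <= e.
  by have /cvgrPdist_le/(_ _ e0) := ch i t.
have := filter_forall (nbhs_filter (t : subspace A)) hnear.
apply: filterS => s hs; apply: mx_norm_leP => [|i j]; first exact: ltW.
rewrite !mxE; apply: le_trans (hs i).
by have := le_coord_mx_norm (h i t - h i s) 0 j; rewrite !mxE.
Qed.

Lemma history_ball_le (d r : R) (c : 'rV[R]_m) h :
  history_ball d r c h -> forall s, - d <= s <= 0 -> enorm (h s - c) <= r.
Proof.
move=> [_ hr] s sd; rewrite -lee_fin; apply: le_trans hr.
by apply: ereal_sup_ubound; exists s => //=; rewrite in_itv.
Qed.

Lemma limf_esup_le (e : R -> R) (M : R) : (forall t, 0 <= t -> e t <= M) ->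
  (limf_esup (fun t => (e t)%:E) (pinfty_nbhs R) <= M%:E)%E.
Proof.
move=> eM; rewrite limf_esupE.
apply: (@le_trans _ _ (ereal_sup ((fun t => (e t)%:E) @` [set t | 0 <= t]))).
  apply: ereal_inf_lbound; exists [set t | 0 <= t] => //=.
  by exists 0; split => // t /ltW.
by apply: ge_ereal_sup => _ [t t0 <-]; rewrite lee_fin; exact: eM.
Qed.

(** Closed-loop solutions are exactly the delay solutions for the closed-loop
    field, rows being replaced by entries. *)
Lemma closed_loop_solutionP E a f g phi (vartheta k0 eps d : R)
    (h : 'I_n -> R -> 'rV[R]_m) (x : R -> V) :
  closed_loop_solution f g (sidt_input E a f g phi vartheta k0 eps) d h x <->
  delay_solution (closed_loop_field E a f g phi vartheta k0 eps) d (stack_rows h) x.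
Proof.
set F := closed_loop_field E a f g phi vartheta k0 eps.
have rowE' i j : (fun s : R => row i (x s) 0 j) = fun s => x s i j.
  by apply/funext => s; rewrite mxE.
split=> -[xh acx aex]; split=> //.
- by move=> s sd; apply/row_matrixP => i; rewrite row_stack_rows xh.
- apply: filterS aex => t xt t0 i j; have /is_derive_rowP/(_ j) := xt t0 i.
  rewrite -row_closed_loop_field mxE.
  by rewrite rowE' => xij; exact: xij.
- by move=> i s sd; rewrite xh// row_stack_rows.
- apply: filterS aex => t xt t0 i; apply/is_derive_rowP => j.
  rewrite -row_closed_loop_field mxE.
  by rewrite rowE'; exact: xt.
Qed.

End Transfer.

Theorem theorem1 (R : realType) (n m : nat)
    (E : rel 'I_n) (hE : symmetric E)
    (a : 'I_n -> 'I_n -> R) (ha_sym : forall i j, a i j = a j i)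
    (ha_pos : forall i j, E i j -> 0 < a i j)
    (ha_0 : forall i j, ~~ E i j -> a i j = 0)
    (f : 'I_n -> 'rV[R]_m -> 'rV[R]_m) (hf : forall i, smooth (f i))
    (hf0 : forall i, f i 0 = 0)
    (g : 'I_n -> 'rV[R]_m -> R) (hg : forall i, smooth (g i))
    (phi : 'I_n -> 'rV[R]_m -> R)
    (xstar : 'M[R]_(n, m)) (hxstar : optimal_solution phi xstar)
    (A1 : forall i, Ck 1 (g i) /\
       exists gmin gmax : R, [/\ 0 < gmin, gmin <= gmax &
         forall x, gmin <= `|g i x| <= gmax])
    (A2 : forall i, Ck 2 (phi i) /\
       exists L : R, forall y z,
         enorm (grad (phi i) y - grad (phi i) z) <= L * enorm (y - z))
    (A3 : forall i, exists2 mu : R, 0 < mu & strongly_convex mu (phi i))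
    (vartheta k0 eps : R) (hvartheta : 0 < vartheta) (hk0 : 0 < k0)
    (heps : 2 * n%:R <= eps) :
  practical_IDTSC f g (sidt_input E a f g phi vartheta k0 eps) xstar.
Proof.
have a_ge0 i j : 0 <= a i j.
  by have [/ha_pos/ltW//|/ha_0->] := boolP (E i j).
have eps_ge0 : 0 <= eps by apply: le_trans heps; rewrite mulr_ge0.
have cons : consensus xstar := hxstar.1.
have [R2 dissip] := closed_loop_field_coercive f A1 A2 A3 hE ha_sym a_ge0
  (ltW hvartheta) eps_ge0 hk0 cons.
have Floc (B : R) (B0 : 0 <= B) :=
  closed_loop_field_local E a vartheta k0 eps A1 A2 xstar hf B0.
have Fmeas := closed_loop_field_measurable E a vartheta k0 eps A1 A2 hf.
move=> r r0.
have [dbar dbar0 [R1 R10 H]] := dissipative_delay_system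
  ((n * m)%:R * r) Floc Fmeas hk0 dissip.
exists dbar => // d dd; exists R1 => //.
have hist h : (forall i, history_ball d r (row i xstar) (h i)) ->
    {within `[- d, 0], continuous (stack_rows h)} /\
    forall s, - d <= s <= 0 -> enorm (stack_rows h s - xstar) <= (n * m)%:R * r.
  move=> hb; split.
    by apply: stack_rows_within_continuous => i; exact: (hb i).1.
  move=> s sd; apply: le_trans (enorm_le_mx_norm _) _; apply: ler_wpM2l => //.
  apply: mx_norm_leP => [|i j]; first exact: ltW.
  apply: le_trans (history_ball_le (hb i) sd).
  have := coord_le_enorm (h i s - row i xstar) 0 j.
  by rewrite !mxE.
split=> [h hb|b R1b].
  have [ch hR0] := hist h hb.
  have [[x xs] uniq bnd] := H d dd (stack_rows h) ch hR0.
  exists x; split.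
  - exact/closed_loop_solutionP.
  - by move=> y /closed_loop_solutionP ys t dt; exact: uniq ys xs t dt.
  - exists (R1 + enorm xstar) => t dt; rewrite -[x t](subrK xstar).
    by apply: le_trans (enormD _ _) _; rewrite lerD2r; exact: bnd.
  - apply: limf_esup_le => t t0; apply: bnd => //.
    by apply: le_trans t0; rewrite oppr_le0; have /andP[/ltW] := dd.
(* The bound [R1] holds from the start, so the entry time is [0]. *)
exists 0 => // h x hb /closed_loop_solutionP xs t t0.
have [ch hR0] := hist h hb.
have [_ _ bnd] := H d dd (stack_rows h) ch hR0.
apply: le_trans (ltW R1b); apply: bnd => //.
by apply: le_trans t0; rewrite oppr_le0; have /andP[/ltW] := dd.
Qed.
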